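(* Let $(V_*,Q,\mathfrak{a},N_0)$ be a polarized Hodge-Lefschetz module of weight $k$, with bigrading $V_{\mathbb{C}}=\bigoplus_{0\le p,q\le k} V^{p,q}$, and let $\mathcal{C}\subset\mathfrak{a}$ be its polarizing cone. Let $m\ge 0$ with $m+2\leq k$ and let $T_1,\dots,T_m,T_{m+1} \in \mathcal{C}$. If $$v\in V^{p,q} \cap \ker(T_1\cdots T_{m+1}),\qquad p+q = k+m,$$ then $$i^{p-q}\, Q\bigl(v, T_1\cdots T_{m} \, \bar v \bigr) \geq 0,$$ with equality if and only if $v=0$.
   Context: Lefschetz property. Let $V=V_*=\bigoplus_{\ell\in\mathbb{Z}}V_\ell$ be a $\mathbb{Z}$-graded finite-dimensional real vector space. A linear map $N\in \mathrm{End}_{-2}(V)$ (i.e. $N V_\ell\subset V_{\ell-2}$ for all $\ell$) satisfies the Lefschetz property relative to $V_*$ if $N^\ell\colon V_\ell\to V_{-\ell}$ is an isomorphism for all $\ell\ge 0$. For such $N$ and $\ell\ge0$, the primitive subspace $P_\ell(N)\subset V_\ell$ is the kernel of $N^{\ell+1}\colon V_\ell\to V_{-\ell-2}$. Polarized Hodge structures. A Hodge structure of weight $d$ on a real vector space $H$ is a decomposition $H_{\mathbb{C}}=\bigoplus_{p+q=d}H^{p,q}$ of its complexification with $\overline{H^{p,q}}=H^{q,p}$. It is polarized by a real bilinear form $B$ on $H$ (extended complex-bilinearly to $H_{\mathbb{C}}$) of parity $(-1)^d$ (symmetric if $d$ is even, skew-symmetric if $d$ is odd) if the Hermitian form $B^h(\cdot,\cdot):=i^{-d}B(\cdot,\overline{\,\cdot\,})$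 makes the decomposition orthogonal and $(-1)^pB^h$ is positive definite on $H^{p,d-p}$. Polarized Hodge-Lefschetz modules. Let $V_*$ be a $\mathbb{Z}$-graded finite-dimensional real vector space, $k$ a positive integer, and $S$ a non-degenerate real bilinear form on $V$ of parity $(-1)^k$. Let $\mathfrak{o}(V,S)$ be the Lie algebra of infinitesimal automorphisms of $(V,S)$, i.e. those $T\in\mathrm{End}(V)$ with $S(Tu,v)+S(u,Tv)=0$, and let $\mathfrak{o}_{-2}(V,S)=\mathfrak{o}(V,S)\cap\mathrm{End}_{-2}(V)$. Let $\mathfrak{a}\subset\mathfrak{o}_{-2}(V,S)$ be an abelian subspace (its elements commute pairwise) and $N_0\in\mathfrak{a}$. Then $(V_*,S,\mathfrak{a},N_0)$ is a polarized Hodge-Lefschetz module of weight $k$ if: (1) there is a bigrading $V_{\mathbb{C}}=\bigoplus_{0\le p,q\le k}V^{p,q}$ with $V^{q,p}=\overline{V^{p,q}}$ such that $(V_\ell)_{\mathbb{C}}=\bigoplus_{p+q=\ell+k}V^{p,q}$ (so it restricts to a Hodge structure of weight $k+\ell$ on $V_\ell$); (2) $T(V^{p,q})\subset V^{p-1,q-1}$ for all $T\in\mathfrak{a}$; (3) $N_0$ satisfies the Lefschetz property; (4) for $\ell\ge0$, the induced Hodge structure on $P_\ell(N_0)\subset V_\ell$ is polarized by the form $S_\ell(\cdot,\cdot):=S(\cdot,N_0^\ell\,\cdot)$. The polarizing cone $\mathcal{C}$ of $(V_*,S,\mathfrak{a},N_0)$ is the largest convex cone in $\mathfrak{a}$ containing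 $N_0$ and such that every element of $\mathcal{C}$ has the Lefschetz property relative to $V_*$. Elements of $\mathfrak{a}$ and the form $Q$ are extended complex-linearly (resp. bilinearly) to $V_{\mathbb{C}}$; the kernel in the claim is taken in $V_{\mathbb{C}}$. An empty product of endomorphisms is the identity. *)

(* Defs.v *)
From HB Require Import structures.
From mathcomp Require Import all_boot all_order all_algebra.
From mathcomp Require Import complex.
From mathcomp Require Import boolp classical_sets reals.

Set Implicit Arguments.
Unset Strict Implicit.
Unset Printing Implicit Defensive.

Import Order.TTheory GRing.Theory Num.Theory.
Import VectorInternalTheory.

Local Open Scope ring_scope.
Local Open Scope complex_scope.

(* The complexification V (x) C of a real vector space V: the pair (x, y)
   stands for x + i y. *)
Definition complexify (R : realType) (V : vectType R) : Type := (V * V)%type.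

Section Complexify.
Context {R : realType} {V : vectType R}.
Local Notation VC := (complexify V).

HB.instance Definition _ := GRing.Zmodule.copy VC (V * V)%type.

Definition cscale (z : R[i]) (x : VC) : VC :=
  (complex.Re z *: x.1 - complex.Im z *: x.2,
   complex.Re z *: x.2 + complex.Im z *: x.1).

Lemma cscaleA (a b : R[i]) (x : VC) :
  cscale a (cscale b x) = cscale (a * b) x.
Proof.
case: a b x => [a a'] [b b'] [x y]; rewrite /cscale /=; congr pair.
  rewrite scalerBr scalerDr !scalerA scalerBl scalerDl !opprD -!addrA.
  by congr (_ + _); rewrite [RHS]addrC -!addrA.
rewrite scalerBr scalerDr !scalerA scalerBl scalerDl -!addrA.
by congr (_ + _); rewrite [RHS]addrC -!addrA; congr (_ + _); rewrite addrC.
Qed.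

Lemma cscale1 : left_id 1 cscale.
Proof. by case=> x y; rewrite /cscale /= !scale1r !scale0r subr0 addr0. Qed.

Lemma cscaleDr : right_distributive cscale +%R.
Proof.
case=> a b [x y] [x' y']; rewrite /cscale /=; congr pair => /=.
  by rewrite !scalerDr opprD addrACA.
by rewrite !scalerDr addrACA.
Qed.

Lemma cscaleDl (x : VC) : {morph cscale^~ x : a b / a + b}.
Proof.
case: x => x y [a a'] [b b']; rewrite /cscale /=; congr pair => /=.
  by rewrite !scalerDl opprD addrACA.
by rewrite !scalerDl addrACA.
Qed.

HB.instance Definition _ := GRing.Zmodule_isLmodule.Build R[i] VC
  cscaleA cscale1 cscaleDr cscaleDl.

Definition c2r (x : VC) : 'rV[R[i]]_(dim V) :=
  \row_j (v2r x.1 0 j +i* v2r x.2 0 j).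

Definition r2c (r : 'rV[R[i]]_(dim V)) : VC :=
  (r2v (map_mx (@complex.Re R) r), r2v (map_mx (@complex.Im R) r)).

Lemma c2r_axiom : vector_axiom (dim V) VC.
Proof.
exists c2r.
  move=> [a a'] [x y] [x' y']; apply/rowP => j.
  rewrite !mxE /= !linearD !linearN !linearZ /= !mxE.
  by rewrite mulrN; apply/eqP; rewrite eq_complex /= !eqxx.
exists r2c => [[x y]|r].
  congr pair; rewrite -[RHS]v2rK; congr r2v; apply/rowP => j; by rewrite !mxE.
by apply/rowP => j; rewrite !mxE /= !r2vK !mxE; case: (r 0 j).
Qed.

HB.instance Definition _ := Lmodule_hasFinDim.Build R[i] VC c2r_axiom.

End Complexify.

Section ComplexExtension.
Context {R : realType} {V : vectType R}.
Local Notation VC := (complexify V).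

Definition vconj (x : VC) : VC := (x.1, - x.2).

Definition embC (u : V) : VC := (u, 0).

Definition subspaceC (U : {vspace V}) : {vspace VC} :=
  <<[seq embC u | u <- vbasis U]>>%VS.

Definition endC_fun (f : 'End(V)) (x : VC) : VC := (f x.1, f x.2).

Lemma endC_fun_is_linear (f : 'End(V)) : linear (endC_fun f).
Proof.
move=> [a a'] [x y] [x' y']; rewrite /endC_fun /=; congr pair => /=.
  by rewrite !linearD linearN !linearZ.
by rewrite !linearD !linearZ.
Qed.

HB.instance Definition _ (f : 'End(V)) :=
  GRing.isLinear.Build R[i] VC VC _ (endC_fun f) (endC_fun_is_linear f).

Definition endC (f : 'End(V)) : 'End(VC) := linfun (endC_fun f).

Definition bilinC (B : {biscalar V}) (x y : VC) : R[i] :=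
  (B x.1 y.1 - B x.2 y.2) +i* (B x.1 y.2 + B x.2 y.1).

Lemma mem_subspaceC (U : {vspace V}) (x : VC) :
  (x \in subspaceC U) = (x.1 \in U) && (x.2 \in U).
Proof.
have memC u : u \in U -> embC u \in subspaceC U.
  move=> /coord_vbasis ->.
  have -> : embC (\sum_(i < \dim U) coord (vbasis U) i u *: (vbasis U)`_i)
      = \sum_(i < \dim U) (coord (vbasis U) i u)%:C *:
                             embC (vbasis U)`_i.
    elim/big_rec2: _ => // i [y1 y2] y _ [-> <-].
    congr pair => /=; first by rewrite scale0r subr0.
    by rewrite scale0r scaler0 !addr0.
  apply: memv_suml => i _; apply/memvZ/memv_span/map_f.
  by rewrite mem_nth // size_tuple.
apply/idP/andP => [|[x1 x2]].
  move=> /coord_span ->.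
  elim/big_rec: _ => [|i [y1 y2] _ [/= y1U y2U]]; first by rewrite !mem0v.
  have /mapP[u /vbasis_mem uU ->] :
      [seq embC u | u <- vbasis U]`_i \in
        [seq embC u | u <- vbasis U] by rewrite mem_nth // size_map size_tuple.
  by rewrite /= !scaler0 subr0 add0r; split; rewrite memvD ?memvZ.
have -> : x = embC x.1 + 'i%C *: embC x.2.
  by case: x {x1 x2} => a b; congr pair => /=;
     rewrite ?scale0r ?scaler0 ?scale1r ?subr0 ?addr0 ?add0r.
by rewrite memvD ?memvZ ?memC.
Qed.

End ComplexExtension.

(* U is the internal direct sum of the W i; all but finitely many W i are 0. *)
Definition is_direct_sum (K : fieldType) (E : vectType K) (I : eqType)
    (W : I -> {vspace E}) (U : {vspace E}) : Prop :=
  exists s : seq I,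
    [/\ uniq s, forall i, i \notin s -> W i = 0%VS,
        directv (\sum_(i <- s) W i)%VS & (\sum_(i <- s) W i)%VS = U].

Section LefschetzProperty.
Context {R : realType} {V : vectType R}.
Implicit Types (gr : int -> {vspace V}) (N T : 'End(V)).

Definition comp_exp N (l : nat) : 'End(V) :=
  \big[@comp_lfun _ _ _ _ / \1%VF]_(i < l) N.

Definition is_grading gr : Prop := is_direct_sum gr fullv.

Definition has_degree gr (d : int) T : Prop :=
  forall l : int, (T @: gr l <= gr (l + d)%R)%VS.

Definition lefschetz gr N : Prop :=
  has_degree gr (- 2) N /\
  forall l : nat, {in gr l &, injective (comp_exp N l)} /\
                  (comp_exp N l @: gr l)%VS = gr (- l%:Z).

Definition primitive gr N (l : nat) : {vspace V} :=
  (gr l :&: lker (comp_exp N l.+1))%VS.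

(* Cones are only required to be stable under strictly positive scalars, so
   that they need not contain 0, which is not Lefschetz in general. *)
Definition convex_cone (C : set 'End(V)) : Prop :=
  (forall (c : R) T, 0 < c -> C T -> C (c *: T)) /\
  (forall (t : R) T T', 0 <= t -> t <= 1 -> C T -> C T' ->
     C (t *: T + (1 - t) *: T')).

Definition lefschetz_cone gr (a : {vspace 'End(V)}) N0 (C : set 'End(V)) :
    Prop :=
  [/\ forall T, C T -> T \in a, convex_cone C, C N0 &
      forall T, C T -> lefschetz gr T].

Definition polarizing_cone gr (a : {vspace 'End(V)}) N0 (C : set 'End(V)) :
    Prop :=
  lefschetz_cone gr a N0 C /\
  forall D : set 'End(V), lefschetz_cone gr a N0 D -> (D `<=` C)%classic.

End LefschetzProperty.

Section Polarization.
Context {R : realType} {V : vectType R}.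
Local Notation VC := (complexify V).
Implicit Types (B : {biscalar V}) (H : int -> int -> {vspace VC}).

(* A Hodge structure of weight d on the subspace U of V. Only the H p q with
   p + q = d are relevant. *)
Definition hodge_structure (d : int) (U : {vspace V}) H : Prop :=
  is_direct_sum (fun p : int => H p (d - p)) (subspaceC U) /\
  (forall p q : int, p + q = d ->
     forall x : VC, (x \in H q p) = (vconj x \in H p q)).

Definition has_parity (d : int) (U : {vspace V}) B : Prop :=
  {in U &, forall u v, B u v = (-1) ^ d * B v u}.

Definition herm_form (d : int) B (x y : VC) : R[i] :=
  'i%C ^ (- d) * bilinC B x (vconj y).

Definition polarized_by (d : int) (U : {vspace V}) H B : Prop :=
  [/\ has_parity d U B,
      forall p p' : int, p != p' ->
        forall x y : VC, x \in H p (d - p) -> y \in H p' (d - p') ->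
          herm_form d B x y = 0 &
      forall (p : int) (x : VC), x \in H p (d - p) -> x != 0 ->
        0 < (-1) ^ p * herm_form d B x x].

Definition twist_form B (f : 'End(V)) (u v : V) : R := B u (f v).

Lemma twist_form_is_bilinear B f :
  bilinear_for *%R *%R (twist_form B f).
Proof.
split=> [u' c u v|u c v v']; rewrite /twist_form; first by rewrite linearPl.
by rewrite linearP linearPr.
Qed.

HB.instance Definition _ B f :=
  bilinear_isBilinear.Build R V V R *%R *%R (twist_form B f)
    (twist_form_is_bilinear B f).

Definition nondegenerate_form B : Prop :=
  forall u : V, (forall v : V, B u v = 0) -> u = 0.

Definition inf_automorphism B (T : 'End(V)) : Prop :=
  forall u v : V, B (T u) v + B u (T v) = 0.

(* H p q is the bigrading component V^{p,q}, indexed by all integers p, q and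
   zero outside the square 0 <= p, q <= k. *)
Record polarized_hodge_lefschetz (gr : int -> {vspace V}) (Q : {biscalar V})
    (a : {vspace 'End(V)}) (N0 : 'End(V)) (k : nat) H : Prop := {
  phl_weight : (0 < k)%N;
  phl_grading : is_grading gr;
  phl_parity : has_parity k fullv Q;
  phl_nondeg : nondegenerate_form Q;
  phl_inf_aut : forall T, T \in a -> inf_automorphism Q T;
  phl_degree : forall T, T \in a -> has_degree gr (- 2) T;
  phl_abelian : {in a &, forall T T', (T \o T' = T' \o T)%VF};
  phl_N0 : N0 \in a;
  phl_range : forall p q : int,
    ~~ [&& 0 <= p, p <= k%:Z, 0 <= q & q <= k%:Z] -> H p q = 0%VS;
  phl_bigrading : is_direct_sum (fun pq : int * int => H pq.1 pq.2) fullv;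
  phl_hodge : forall l : int, hodge_structure (k%:Z + l) (gr l) H;
  phl_shift : forall T, T \in a ->
    forall p q : int, (endC T @: H p q <= H (p - 1)%R (q - 1)%R)%VS;
  phl_lefschetz : lefschetz gr N0;
  phl_polarized : forall l : nat,
    let P := primitive gr N0 l in
    let HP := fun p q : int => (H p q :&: subspaceC P)%VS in
    hodge_structure (k%:Z + l%:Z) P HP /\
    polarized_by (k%:Z + l%:Z) P HP (twist_form Q (comp_exp N0 l))
}.

End Polarization.

(* Main.v *)
From HB Require Import structures.
Require Import Defs.
From mathcomp Require Import all_boot all_order all_algebra.
From mathcomp Require Import complex.
From mathcomp Require Import boolp classical_sets reals.
From mathcomp Require Import ring lra zify.

(** Fix p - q and call V^{p,q} the space of level m, where p + q = k + m >= k; the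
next level is m + 2, with (p+1, q+1). A product L of m elements of the cone gives
the Hermitian form h_L(x, y) = i^(p-q) Q(x, L conj y) on V^{p,q}. The idea is to
show that h_L is nondegenerate and has the same signature as for L = N0^m; the
positivity on the kernel of one more factor then follows by counting dimensions.

From signatures to positivity (hodge_riemann_of_index). For B in the cone,
h_L(B x, B y) = - h_{BBL}(x, y), so B maps a maximal positive subspace of level
m + 2 injectively to a negative subspace of level m. By the Lefschetz
decomposition for N0 its dimension is the full negative index of level m. A
vector v with B L v = 0 is orthogonal to it, hence h_L(v, v) > 0 unless v = 0.

The signature (neg_index_cone). The same subspace shows, by downward induction on
the level, that the negative index is at least the expected one. For the opposite
bound, consider products A_1 ... A_r B^l and argue by induction on r. Let
A = A_r, deform B to A through S = (1 - s) B + s A, which stays in the cone, and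
ask where A_1 ... A_r S^l is degenerate. If u is in its kernel, then w = A u is a
nonzero vector of level m - 2 which is killed by A_1 ... A_{r-1} S^l, and the
positivity already known for r - 1 gives h(w, w) > 0 for the product
A_1 ... A_{r-1} S^(l-1). Up to a positive factor the derivative of the form at u
in the direction of A is - h(w, w) < 0. So every vanishing eigenvalue becomes
negative on the way from B to A, and the number of nonpositive eigenvalues at B is
at most the negative index at A, where the claim holds by induction. The two
bounds agree, and therefore no degeneration occurs at all. For r = 0 the segment
from B to N0 is nondegenerate throughout by the Lefschetz property.

The passage through a degenerate parameter (nonpos_dim_crossing) is elementary:
near it the form is compared with its diagonalization, after rescaling the kernel
vectors so that the Gram matrix has an invertible limit. *)

Set Implicit Arguments.
Unset Strict Implicit.
Unset Printing Implicit Defensive.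

Import Order.TTheory GRing.Theory Num.Theory.

Local Open Scope ring_scope.

(** * Hermitian forms, their diagonalization and negative index *)

Section HermitianForms.
Context {C : numClosedFieldType} {F : vectType C}.
Implicit Types (h : F -> F -> C) (U E : {vspace F}) (x y z : F) (e f : seq F).

(** Hermitian forms as plain functions: the forms below come in families that
depend on a real parameter and on a list of endomorphisms, with this property
proved only under side conditions. *)
Definition is_hermitian h :=
  (forall a x y z, h (a *: x + y) z = a * h x z + h y z) /\
  (forall x y, h y x = (h x y)^*).

Definition pos_on h U := forall x, x \in U -> x != 0 -> 0 < h x x.
Definition nonpos_on h U := forall x, x \in U -> h x x <= 0.
Definition orthonormal_seq h e :=
  forall i j, (i < size e)%N -> (j < size e)%N -> h e`_i e`_j = (i == j)%:R.

Section Basics.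
Variables (h : F -> F -> C) (hh : is_hermitian h).

Lemma herm0l z : h 0 z = 0.
Proof. by have := hh.1 (-1) 0 0 z; rewrite scaler0 addr0 mulN1r addNr. Qed.
Lemma hermDl x y z : h (x + y) z = h x z + h y z.
Proof. by rewrite -[x]scale1r hh.1 mul1r scale1r. Qed.
Lemma hermZl a x z : h (a *: x) z = a * h x z.
Proof. by rewrite -[a *: x]addr0 hh.1 herm0l addr0. Qed.
Lemma herm_conj x y : h y x = (h x y)^*.
Proof. exact: hh.2. Qed.
Lemma herm0r z : h z 0 = 0.
Proof. by rewrite herm_conj herm0l conjC0. Qed.
Lemma hermDr x y z : h z (x + y) = h z x + h z y.
Proof. by rewrite herm_conj hermDl rmorphD /= -!herm_conj. Qed.
Lemma hermZr a x z : h z (a *: x) = a^* * h z x.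
Proof. by rewrite herm_conj hermZl rmorphM /= -!herm_conj. Qed.
Lemma herm_suml I (r : seq I) (v : I -> F) z :
  h (\sum_(i <- r) v i) z = \sum_(i <- r) h (v i) z.
Proof. by elim/big_rec2: _ => [|i a b _ <-]; rewrite ?herm0l ?hermDl. Qed.
Lemma herm_sumr I (r : seq I) (v : I -> F) z :
  h z (\sum_(i <- r) v i) = \sum_(i <- r) h z (v i).
Proof. by elim/big_rec2: _ => [|i a b _ <-]; rewrite ?herm0r ?hermDr. Qed.
Lemma herm_real x : h x x \is Num.real.
Proof. by rewrite CrealE -herm_conj. Qed.
Lemma herm_eq0C x y : (h x y == 0) = (h y x == 0).
Proof. by rewrite (herm_conj x y) conjC_eq0. Qed.

Lemma hermitianN : is_hermitian (fun x y => - h x y).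
Proof.
split=> [a x y z|x y]; first by rewrite hh.1 opprD mulrN.
by rewrite herm_conj rmorphN.
Qed.

(** Polarization: the values at x + y and x + i y give the real and the imaginary
part of h x y. *)
Lemma herm_isotropic E :
  (forall x, x \in E -> h x x = 0) -> {in E &, forall x y, h x y = 0}.
Proof.
move=> h0 x y xE yE.
have e1 : h x y + h y x = 0.
  have := h0 (x + y) (memvD xE yE).
  by rewrite hermDl !hermDr !h0 // add0r addr0.
have e2 : - 'i * h x y + 'i * h y x = 0.
  have := h0 (x + 'i *: y) (memvD xE (memvZ _ yE)).
  by rewrite hermDl !hermDr !hermZl !hermZr !h0 // !mulr0 add0r addr0 conjCi.
have e3 : h y x = - h x y by apply/eqP; rewrite -addr_eq0 addrC e1.
move/eqP: e2; rewrite e3 mulrN mulNr -opprD oppr_eq0 -mulr2n mulrn_eq0 /=.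
by rewrite mulf_eq0 (negPf (neq0Ci _)) => /eqP.
Qed.

Lemma pos_nonpos_dim E P N : (P <= E)%VS -> (N <= E)%VS ->
  pos_on h P -> nonpos_on h N -> (\dim P + \dim N <= \dim E)%N.
Proof.
move=> PE NE hP hN; rewrite -dimv_disjoint_sum ?dimvS ?subv_add ?PE //.
apply/eqP; rewrite -subv0; apply/subvP => x; rewrite memv_cap memv0.
case/andP=> xP xN; apply: contraT => x0.
by have := lt_le_trans (hP x xP x0) (hN x xN); rewrite ltxx.
Qed.

(** If the Gram matrix of r vectors differs from the identity by at most 1/(r+1)
in every entry, then h is at least 1 - r/(r+1) times the standard Hermitian form
in the coefficients. This makes positivity stable under perturbation without any
topology on subspaces. *)
Lemma near_orthonormal_pos e :
  (forall i j : 'I_(size e),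
     `|h e`_i e`_j - (i == j)%:R| <= (size e).+1%:R^-1) ->
  free e /\ pos_on h <<e>>.
Proof.
set r := size e => near.
pose v (c : 'I_r -> C) := \sum_i c i *: e`_i.
have ge c : (1 - r%:R / r.+1%:R) * (\sum_i `|c i| ^+ 2) <= h (v c) (v c).
  have hv : h (v c) (v c) = \sum_i `|c i| ^+ 2 +
     \sum_i \sum_j c i * (c j)^* * (h e`_i e`_j - (i == j)%:R).
    rewrite /v herm_suml -big_split /=; apply: eq_bigr => i _.
    rewrite herm_sumr normCK.
    rewrite (eq_bigr (fun j => c i * (c j)^* * (h e`_i e`_j - (i == j)%:R)
       + c i * (c j)^* * (i == j)%:R)); last first.
      move=> j _; rewrite hermZl hermZr -mulrDr subrK mulrA //.
    rewrite big_split /= addrC; congr (_ + _).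
    rewrite (bigD1 i) //= eqxx mulr1 big1 ?addr0 // => j ne.
    by rewrite eq_sym (negPf ne) mulr0.
  rewrite hv mulrBl mul1r lerD2l.
  set S := \sum_i \sum_j _.
  have Sreal : S \is Num.real.
    have -> : S = h (v c) (v c) - \sum_i `|c i| ^+ 2 by rewrite hv addrAC subrr add0r.
    rewrite rpredB ?herm_real // rpred_sum // => i _; exact/rpredX/normr_real.
  have : `|S| <= r%:R / r.+1%:R * (\sum_i `|c i| ^+ 2).
    apply: le_trans (ler_norm_sum _ _ _) _.
    have b i j : `|c i * (c j)^* * (h e`_i e`_j - (i == j)%:R)| <=
       r.+1%:R^-1 * ((`|c i| ^+ 2 + `|c j| ^+ 2) / 2%:R).
      rewrite !normrM norm_conjC mulrC.
      apply: ler_pM; rewrite ?mulr_ge0 ?near //.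
      rewrite ler_pdivlMr ?ltr0n // -subr_ge0.
      have -> : `|c i| ^+ 2 + `|c j| ^+ 2 - `|c i| * `|c j| * 2%:R = (`|c i| - `|c j|) ^+ 2.
        by ring.
      by rewrite real_exprn_even_ge0 // rpredB ?normr_real.
    apply: le_trans (ler_sum _ (fun i _ => ler_norm_sum _ _ _)) _.
    apply: le_trans (ler_sum _ (fun i _ => ler_sum _ (fun j _ => b i j))) _.
    under eq_bigr do rewrite -mulr_sumr -mulr_suml big_split /= sumr_const card_ord.
    rewrite -mulr_sumr -mulr_suml big_split /= sumr_const card_ord sumrMnl.
    rewrite -mulr2n -[_ *+ 2]mulr_natr mulfK ?pnatr_eq0 //.
    by rewrite -[_ *+ r]mulr_natl mulrA [_^-1 * _]mulrC.
  by rewrite real_ler_norml // => /andP[].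
have gt0 c : (exists i, c i != 0) -> 0 < h (v c) (v c).
  move=> [i ci]; apply: lt_le_trans (ge c); apply: mulr_gt0.
    by rewrite subr_gt0 ltr_pdivrMr ?ltr0Sn // mul1r ltr_nat.
  rewrite (bigD1 i) //= ltr_pwDl ?exprn_gt0 ?normr_gt0 //.
  by apply: sumr_ge0 => j _; rewrite exprn_ge0.
split.
  apply/(@freeP _ _ _ (in_tuple e)) => c vc i; apply/eqP; apply: contraT => ci.
  have := gt0 c (ex_intro _ i ci); rewrite /v.
  by rewrite (_ : \sum_i _ = 0) ?herm0l ?ltxx //.
move=> x xe x0; rewrite (coord_span (X := in_tuple e) xe).
apply: gt0; apply/existsP; rewrite -negb_forall; apply: contra x0 => /forallP c0.
rewrite (coord_span (X := in_tuple e) xe) big1 // => i _.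
by rewrite (eqP (c0 i)) scale0r.
Qed.

End Basics.

(** Sylvester's theorem with an explicit radical K. Induction on the dimension: a
vector x with h x x != 0 is normalized to h x x = 1 or -1 and split off with its
orthogonal complement; if there is none, E is its own radical. *)
Lemma diagonalization h E : is_hermitian h ->
  exists e f K, [/\ (<<e>> <= E)%VS, (<<f>> <= E)%VS, (K <= E)%VS &
   [/\ orthonormal_seq h e, orthonormal_seq (fun x y => - h x y) f,
    {in e & f, forall x y, h x y = 0},
    {in K & E, forall x y, h x y = 0} &
    (size e + size f + \dim K = \dim E)%N]].
Proof.
move=> hh; move dE : (\dim E) => n; elim: n E dE => [|n IH] E dE.
  exists [::], [::], E; rewrite !span_nil !sub0v subvv; split => //; split => //=.
  move=> x y; move/eqP: dE; rewrite dimv_eq0 => /eqP ->.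
  by rewrite memv0 => /eqP -> _; rewrite herm0l.
have [h0|] := pselect (forall x, x \in E -> h x x = 0).
  exists [::], [::], E; rewrite !span_nil !sub0v subvv; split => //; split => //=.
  exact: herm_isotropic.
move=> /existsNP[x0 /not_implyP[x0E /eqP hx0]].
pose x := (sqrtC `|h x0 x0|)^-1 *: x0.
have xE : x \in E by apply: memvZ.
have hx : h x x = h x0 x0 / `|h x0 x0|.
  rewrite /x hermZl // hermZr // fmorphV /= conj_Creal; last first.
    by rewrite ger0_real // sqrtC_ge0.
  by rewrite mulrA -invfM -expr2 sqrtCK mulrC.
have /orP hx1 : (h x x == 1) || (h x x == -1).
  rewrite hx; have := herm_real hh x0; rewrite realE => /orP[] c.
    by rewrite ger0_norm // divff ?eqxx.
  by rewrite ler0_norm // invrN mulrN divff // eqxx orbT.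
have hxx0 : h x x != 0 by case: hx1 => /eqP->; rewrite ?oppr_eq0 oner_eq0.
have x_neq0 : x != 0 by apply: contraNneq hxx0 => ->; rewrite herm0l.
have linh : linear (fun y => h y x : C^o) by move=> a y z; rewrite hh.1.
pose l : {linear F -> C^o} := HB.pack (fun y => h y x : C^o)
  (GRing.isLinear.Build _ _ _ _ _ linh).
pose E' := (E :&: lker (linfun l))%VS.
have memE' y : (y \in E') = (y \in E) && (h y x == 0).
  by rewrite memv_cap memv_ker lfunE.
have E'E : (E' <= E)%VS by apply: capvSl.
have decE y : y \in E -> exists a z, z \in E' /\ y = a *: x + z.
  move=> yE; exists (h y x / h x x), (y - (h y x / h x x) *: x).
  split; last by rewrite addrC subrK.
  rewrite memE' memvB ?memvZ //= -scaleNr hermDl // hermZl //.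
  by rewrite mulNr divfK // subrr.
have dE' : \dim E' = n.
  apply/eqP; rewrite -eqSS -dE.
  have -> : E = (<[x]> + E')%VS.
    apply/eqP; rewrite eqEsubv; apply/andP; split; last first.
      by rewrite subv_add E'E andbT -memvE.
    apply/subvP => y /decE[a [z [zE' ->]]].
    by apply: memv_add => //; apply: memvZ; apply: memv_line.
  rewrite dimv_disjoint_sum; last first.
    apply/eqP; rewrite -subv0; apply/subvP => y; rewrite memv_cap memv0.
    case/andP=> /vlineP[a ->]; rewrite memE' => /andP[_].
    by rewrite hermZl // mulf_eq0 (negPf hxx0) orbF => /eqP ->; rewrite scale0r.
  by rewrite dim_vline x_neq0.
have [e [f [K [eE' fE' KE' [oe ofm ef kE' sz]]]]] := IH _ dE'.
have xperp (g : seq F) : (<<g>> <= E')%VS -> {in g, forall y, h x y = 0}.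
  move=> /subvP gE y /memv_span /gE; rewrite memE' => /andP[_].
  by rewrite herm_eq0C // => /eqP.
have KE : {in K & E, forall y z, h y z = 0}.
  move=> y z yK /decE[a [w [wE ->]]]; rewrite hermDr // hermZr // (kE' y w) // addr0.
  by have /subvP/(_ y yK) := KE'; rewrite memE' => /andP[_ /eqP ->]; rewrite mulr0.
have ortho (h' : F -> F -> C) (g : seq F) : is_hermitian h' ->
    h' x x = 1 -> {in g, forall y, h' x y = 0} ->
    orthonormal_seq h' g -> orthonormal_seq h' (x :: g).
  move=> hh' x1 xg og [|i] [|j] //=; rewrite ?ltnS => ? ?; last by rewrite og.
    by rewrite xg ?mem_nth.
  by apply/eqP; rewrite herm_eq0C // xg ?mem_nth.
have subE (g : seq F) : (<<g>> <= E')%VS -> (<<x :: g>> <= E)%VS.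
  by move=> gE; rewrite span_cons subv_add -memvE xE (subv_trans gE).
case: hx1 => /eqP hx1.
- exists (x :: e), f, K; split; rewrite ?subE ?(subv_trans _ E'E) //.
  split=> //; last by rewrite /= !addSn sz.
  + by apply: ortho => //; apply: xperp.
  + move=> y z; rewrite inE => /orP[/eqP -> zf|]; last exact: ef.
    exact: (xperp f).
- exists e, (x :: f), K; split; rewrite ?subE ?(subv_trans _ E'E) //.
  split=> //; last by rewrite /= addnS !addSn sz.
  + apply: ortho => //; first exact: hermitianN.
      by rewrite hx1 opprK.
    by move=> y yf; rewrite (xperp f) ?oppr0.
  + move=> y z ye; rewrite inE => /orP[/eqP ->|]; last exact: ef.
    by apply/eqP; rewrite herm_eq0C // (xperp e).
Qed.
Lemma orthonormal_pos h e : is_hermitian h -> orthonormal_seq h e ->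
  free e /\ pos_on h <<e>>.
Proof.
move=> hh oe; apply: near_orthonormal_pos => // i j.
by rewrite oe // subrr normr0 invr_ge0 ler0n.
Qed.

Lemma orthonormal_basis h P : is_hermitian h -> pos_on h P ->
  exists e, <<e>>%VS = P /\ orthonormal_seq h e.
Proof.
move=> hh pP; have [e [f [K [eP fP KP [oe ofm ef kP sz]]]]] := diagonalization P hh.
have [ie _] := orthonormal_pos hh oe.
have [jf pf] := orthonormal_pos (hermitianN hh) ofm.
have f0 : size f = 0%N.
  rewrite -(eqP jf); apply/eqP; rewrite dimv_eq0; apply: contraT => f0.
  have := pf _ (memv_pick _); rewrite vpick0 f0 => /(_ isT).
  by rewrite oppr_gt0 lt_gtF // pP ?(subvP fP) ?memv_pick ?vpick0.
have K0 : \dim K = 0%N.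
  apply/eqP; rewrite dimv_eq0; apply: contraT => K0.
  have := pP (vpick K); rewrite kP ?memv_pick ?(subvP KP) ?memv_pick // ltxx vpick0 K0.
  exact.
exists e; split=> //; apply/eqP; rewrite eqEdim eP -sz f0 K0 !addn0 (eqP ie) leqnn.
by [].
Qed.

Lemma pos_nonpos_split h E : is_hermitian h ->
  exists P W, [/\ (P <= E)%VS, (W <= E)%VS, pos_on h P, nonpos_on h W
    & (\dim P + \dim W = \dim E)%N].
Proof.
move=> hh; have [e [f [K [eE fE KE [oe ofm ef kE sz]]]]] := diagonalization E hh.
have [ie pe] := orthonormal_pos hh oe.
have [jf pf] := orthonormal_pos (hermitianN hh) ofm.
exists <<e>>%VS, (<<f>> + K)%VS; split=> //; first by rewrite subv_add fE.
  move=> x /memv_addP[y yf [z zK ->]].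
  have zy : h z y = 0 by apply: kE => //; apply: (subvP fE).
  have zz : h z z = 0 by apply: kE => //; apply: (subvP KE).
  rewrite hermDl // !hermDr // zz zy (herm_conj hh z y) zy conjC0 !addr0.
  have [->|y0] := eqVneq y 0; first by rewrite herm0l.
  by have := pf y yf y0; rewrite oppr_gt0 => /ltW.
rewrite dimv_disjoint_sum ?(eqP ie) ?(eqP jf) ?addnA //.
apply/eqP; rewrite -subv0; apply/subvP => x; rewrite memv_cap memv0 => /andP[xf xK].
by apply: contraT => x0; have := pf x xf x0; rewrite kE ?oppr0 ?ltxx // (subvP KE).
Qed.

(** The form is nondegenerate on E with signature (dim E - b, b). *)
Definition has_neg_index h E (b : nat) :=
  exists P N, [/\ (P <= E)%VS, (N <= E)%VS, pos_on h P, pos_on (fun x y => - h x y) N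
   & \dim N = b /\ (\dim P + b = \dim E)%N].

Lemma neg_nonpos h N : is_hermitian h ->
  pos_on (fun x y => - h x y) N -> nonpos_on h N.
Proof.
move=> hh neg x xN; have [->|x0] := eqVneq x 0; first by rewrite herm0l.
by have := neg x xN x0; rewrite oppr_gt0 => /ltW.
Qed.

Lemma neg_index_nonpos h E b W : has_neg_index h E b ->
  (W <= E)%VS -> nonpos_on h W -> (\dim W <= b)%N.
Proof.
case=> P [N [PE NE pP nN [dN dE]]] WE nW.
by have := pos_nonpos_dim PE WE pP nW; rewrite -dE leq_add2l.
Qed.

(** A vector orthogonal to a maximal negative subspace N is positive: otherwise it
would extend N to a nonpositive subspace of dimension b + 1. *)
Lemma neg_index_perp h E b N u : is_hermitian h ->
  has_neg_index h E b -> (N <= E)%VS -> pos_on (fun x y => - h x y) N -> \dim N = b ->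
  u \in E -> (forall y, y \in N -> h u y = 0) -> u != 0 -> 0 < h u u.
Proof.
move=> hh sg NE nN dN uE uN u0.
have /orP[huu|//] : (h u u <= 0) || (0 < h u u).
  have := herm_real hh u; rewrite realE le0r.
  by move=> /orP[/orP[/eqP ->|->]|->]; rewrite ?lexx ?orbT.
have uNN : u \notin N.
  apply/negP => uinN; have := nN u uinN u0.
  by rewrite uN // oppr0 ltxx.
have := neg_index_nonpos (W := (N + <[u]>)%VS) sg.
rewrite subv_add NE -memvE uE => /(_ isT).
rewrite dimv_disjoint_sum; last first.
  apply/eqP; rewrite -subv0; apply/subvP => x; rewrite memv_cap memv0.
  case/andP=> xN /vlineP[c xc]; move: xN; rewrite xc.
  have [->|c0] := eqVneq c 0; first by rewrite scale0r.
  by rewrite rpredZeq (negPf c0) (negPf uNN).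
rewrite dN dim_vline u0 addn1 ltnn => abs; suff : false by [].
apply: abs => x /memv_addP[y yN [z /vlineP[c ->] ->]].
rewrite hermDl // !hermDr // !hermZl // !hermZr // uN // (herm_conj hh u y) uN //.
rewrite conjC0 !mulr0 addr0 add0r mulrA -normCK.
rewrite -[leRHS]addr0; apply: lerD; first by apply: (neg_nonpos hh nN).
by rewrite mulr_ge0_le0 // exprn_ge0.
Qed.

Lemma neg_index_nondeg h E b u : is_hermitian h ->
  has_neg_index h E b -> u \in E -> (forall y, y \in E -> h u y = 0) -> u = 0.
Proof.
move=> hh sg uE u0; have [P [N [PE NE pP nN [dN dE]]]] := sg.
apply/eqP; apply: contraT => un0.
have := neg_index_perp hh sg NE nN dN uE (fun y yN => u0 y (subvP NE y yN)) un0.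
by rewrite u0 // ltxx.
Qed.

Lemma neg_index_of_bounds h E b N : is_hermitian h ->
  (N <= E)%VS -> pos_on (fun x y => - h x y) N -> \dim N = b ->
  (forall W, (W <= E)%VS -> nonpos_on h W -> (\dim W <= b)%N) -> has_neg_index h E b.
Proof.
move=> hh NE nN dN ub.
have [P [W [PE WE pP nW dPW]]] := pos_nonpos_split E hh.
exists P, N; split=> //; split=> //.
have := pos_nonpos_dim PE NE pP (neg_nonpos hh nN); have := ub W WE nW.
rewrite dN -dPW leq_add2l => h1 h2; congr addn; lia.
Qed.

Lemma neg_index0 h E : E = 0%VS -> has_neg_index h E 0.
Proof.
move=> ->; exists 0%VS, 0%VS; rewrite !sub0v dimv0; split=> // x;
by rewrite memv0 => ->.
Qed.

End HermitianForms.

(** * Taylor estimates and induction along [0, 1] *)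

Section PolynomialBounds.
Context {C : numFieldType}.
Implicit Types (p : {poly C}) (c x : C).

Lemma horner_bounded p : exists2 M : C, 0 <= M & forall x, `|x| <= 1 -> `|p.[x]| <= M.
Proof.
exists (\sum_(i < size p) `|p`_i|) => [|x x1]; first by apply: sumr_ge0.
rewrite horner_coef; apply: le_trans (ler_norm_sum _ _ _) _.
apply: ler_sum => i _; rewrite normrM normrX -[leRHS]mulr1.
by rewrite ler_wpM2l // exprn_ile1.
Qed.

Lemma horner_lipschitz p c : exists2 M : C, 0 <= M &
  forall x, `|x| <= 1 -> `|p.[c + x] - p.[c]| <= M * `|x|.
Proof.
have /factor_theorem[q pq] : root (p - p.[c]%:P) c.
  by rewrite rootE !hornerE subrr.
have [M M0 hM] := horner_bounded (q \Po ('X + c%:P)).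
exists M => // x x1.
have -> : p.[c + x] - p.[c] = (q \Po ('X + c%:P)).[x] * x.
  transitivity (p - p.[c]%:P).[c + x]; first by rewrite !hornerE.
  by rewrite pq horner_comp !hornerE [c + x]addrC addrK.
by rewrite normrM ler_wpM2r // hM.
Qed.

(** Dividing p - p.[c] twice by 'X - c leaves a quotient that is bounded on the unit
disc around c. *)
Lemma horner_taylor1 p c : exists2 M : C, 0 <= M &
  forall x, `|x| <= 1 -> `|p.[c + x] - p.[c] - x * p^`().[c]| <= M * `|x| ^+ 2.
Proof.
have /factor_theorem[q pq] : root (p - p.[c]%:P) c.
  by rewrite rootE !hornerE subrr.
have [M M0 hM] := horner_lipschitz q c.
have dq : p^`().[c] = q.[c].
  have -> : p^`() = (p - p.[c]%:P)^`() by rewrite derivB derivC subr0.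
  by rewrite pq derivM derivXsubC !hornerE subrr mulr0 add0r.
exists M => // x x1.
have -> : p.[c + x] - p.[c] - x * p^`().[c] = (q.[c + x] - q.[c]) * x.
  rewrite dq mulrBl [q.[c] * x]mulrC; congr (_ - _).
  transitivity (p - p.[c]%:P).[c + x]; first by rewrite !hornerE.
  by rewrite pq !hornerE [c + x]addrC addrK.
by rewrite normrM expr2 mulrA ler_wpM2r // hM.
Qed.

End PolynomialBounds.

(** A subset of [0, 1] that contains 0, is closed under limits from the left and
can be continued to the right is all of [0, 1]; the supremum of the initial
segments that it contains cannot be smaller than 1. *)
Lemma real_induction (R : realType) (I : R -> Prop) : I 0 ->
  (forall c, 0 < c -> c <= 1 -> (forall s, 0 <= s -> s < c -> I s) -> I c) ->
  (forall c, 0 <= c -> c < 1 -> I c ->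
     exists2 d, 0 < d & forall s, c < s -> s < c + d -> I s) ->
  I 1.
Proof.
move=> I0 Iclosed Iopen.
pose S := [set s : R | 0 <= s <= 1 /\ forall s', 0 <= s' -> s' <= s -> I s']%classic.
have S0 : S 0.
  split; first by rewrite lexx ler01.
  by move=> s s0 s0'; have -> : s = 0 by apply/le_anti/andP.
have hS : has_sup S.
  by split; [exists 0 | exists 1 => s [/andP[]]].
set c := sup S.
have c0 : 0 <= c by apply: (ub_le_sup hS.2).
have c1 : c <= 1 by apply: ge_sup; [exists 0 | move=> s [/andP[]]].
have below s : 0 <= s -> s < c -> I s.
  move=> s0 sc; have [] := @sup_adherent _ S (c - s) _ hS; first by rewrite subr_gt0.
  by move=> u [_ hu]; rewrite -/c opprB addrC subrK => /ltW; apply: hu.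
have Ic : I c.
  by have [<- //|cn0] := eqVneq 0 c; apply: Iclosed; rewrite // lt_neqAle cn0.
have [<- //|cn1] := eqVneq c 1.
have {cn1} c_lt1 : c < 1 by rewrite lt_neqAle cn1.
have [d d0 hd] := Iopen c c0 c_lt1 Ic.
(* a point beyond the supremum c up to which I still holds *)
pose u := Num.min 1 (c + d / 2).
have cu : c < u by rewrite lt_min c_lt1 ltrDl divr_gt0.
have : u <= c.
  apply: (ub_le_sup hS.2); split.
    by rewrite (le_trans c0 (ltW cu)) ge_min lexx.
  move=> s s0 su; have [sc|cs|->//] := ltgtP s c; first exact: below.
  apply: hd => //; apply: le_lt_trans su _.
  by rewrite gt_min; apply/orP; right; lra.
by rewrite leNgt cu.
Qed.

(** * Deformation of Hermitian forms with one-sided degeneration *)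

Section Crossing.
Context {R : realType} {F : vectType R[i]}.
Local Notation C := R[i].
Variables (h dh : R -> F -> F -> C) (E : {vspace F}).
Hypothesis hh : forall s, is_hermitian (h s).
Hypothesis dhh : forall s, is_hermitian (dh s).
Hypothesis hpoly : forall x y, exists p : {poly C},
  (forall s, h s x y = p.[s%:C%C]) /\ (forall s, dh s x y = p^`().[s%:C%C]).
Hypothesis hcross : forall s, 0 <= s -> s < 1 -> forall u, u \in E -> u != 0 ->
  (forall y, y \in E -> h s u y = 0) -> dh s u u < 0.

(** Finitely many errors of order t are all below 1/(r+1) for t small: the sum of
their Lipschitz constants bounds each of them. *)
Lemma small_family r (err : 'I_r -> 'I_r -> R -> C) (P : R -> Prop) :
  (forall i j, exists2 M : C, 0 <= M & forall t, P t -> err i j t <= M * `|t|%:C%C) ->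
  exists2 d : R, 0 < d & forall t, P t -> `|t| < d -> forall i j, err i j t <= r.+1%:R^-1.
Proof.
move=> hM.
have [M hM2] : exists M : 'I_r -> 'I_r -> C, forall i j, 0 <= M i j /\
    forall t, P t -> err i j t <= M i j * `|t|%:C%C.
  have [|M hM'] := choice (P := fun ij (m : C) => 0 <= m /\
    forall t, P t -> err ij.1 ij.2 t <= m * `|t|%:C%C).
    by move=> [i j]; have [m] := hM i j; exists m.
  by exists (fun i j => M (i, j)) => i j; apply: (hM' (i, j)).
pose T := \sum_i \sum_j M i j.
have T0 : 0 <= T by apply: sumr_ge0 => i _; apply: sumr_ge0 => j _; have [] := hM2 i j.
have [tau tau0 Ttau] : exists2 tau : R, 0 <= tau & T = tau%:C%C.
  exists (complex.Re T); last first.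
    apply/eqP; rewrite eq_complex /= eqxx /=.
    by case: T T0 => a b /=; rewrite lecE /= => /andP[].
  by case: T T0 => a b /=; rewrite lecE => /andP[].
exists ((r.+1%:R * (tau + 1))^-1); first by rewrite invr_gt0 mulr_gt0 // ltr_wpDl.
move=> t Pt td i j; have [Mij hMij] := hM2 i j.
apply: le_trans (hMij t Pt) _.
have MT : M i j <= T.
  rewrite /T (bigD1 i) //= (bigD1 j) //= -addrA lerDl addr_ge0 ?sumr_ge0 //.
    by move=> l _; have [] := hM2 i l.
  by move=> k _; apply: sumr_ge0 => l _; have [] := hM2 k l.
apply: le_trans (ler_wpM2r _ MT) _; first by rewrite ler0c.
rewrite Ttau -rmorphM /= (_ : _^-1 = (r.+1%:R^-1)%:C%C); last first.
  by rewrite fmorphV /= rmorph_nat.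
rewrite lecR; apply: le_trans (ler_wpM2l tau0 (ltW td)) _.
rewrite invfM mulrCA ler_piMr ?invr_ge0 // ler_pdivrMr ?ltr_wpDl // mul1r.
by rewrite lerDl.
Qed.

Lemma normC_real (t : R) : `|t%:C%C| = `|t|%:C%C.
Proof.
have [t0|t0] := leP 0 t; first by rewrite !ger0_norm // ler0c.
by rewrite !ltr0_norm ?rmorphN ?(ltcR t 0).
Qed.

Lemma pos_on_nearby c e : orthonormal_seq (h c) e ->
  exists2 d : R, 0 < d & forall t, `|t| < d -> pos_on (h (c + t)) <<e>>.
Proof.
move=> oe; pose r := size e.
have [|d d0 hd] := @small_family r
   (fun i j t => `|h (c + t) e`_i e`_j - (i == j)%:R|) (fun t => `|t| <= 1).
  move=> i j; have [p [hp _]] := hpoly e`_i e`_j.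
  have [M M0 hM] := horner_lipschitz p c%:C%C.
  exists M => // t t1; rewrite -(oe i j) // !hp rmorphD -normC_real; apply: hM.
  by rewrite normC_real lecR.
exists (Num.min 1 d); first by rewrite lt_min ltr01.
move=> t; rewrite lt_min => /andP[t1 td].
by have [] := near_orthonormal_pos (hh (c + t)) (hd t (ltW t1) td).
Qed.

Definition nonpos_dim s d :=
  exists W, [/\ (W <= E)%VS, nonpos_on (h s) W & (d <= \dim W)%N].

(** Nonpositive dimension survives to the right of any c < 1, even if h c is
degenerate. Let f be an orthonormal basis of a maximal negative subspace of h c
and f' a basis of the radical of h c that is orthonormal for - dh c, which exists
because dh c is negative there. At the parameter c + t^2, the vectors f_i and
f'_j / t have Gram matrix - identity + O(t): the entries between f' and f' are
dh c + O(t^2), and the mixed ones, which vanish to first order in t^2, are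
O(t). *)
Lemma nonpos_dim_right c d : 0 <= c -> c < 1 -> nonpos_dim c d ->
  exists2 eps : R, 0 < eps & forall s, c < s -> s < c + eps -> nonpos_dim s d.
Proof.
move=> c0 c1 [W [WE W0 dW]].
have [e [f [K [eE fE KE [oe ofm ef kE sz]]]]] := diagonalization E (hh c).
have [e' [f' [K' [eK' fK' KK' [oe' of' ef' kK' sz']]]]] := diagonalization K (dhh c).
have ker_neg u : u \in K -> u != 0 -> dh c u u < 0.
  by move=> uK u0; apply: hcross => //; [apply: (subvP KE)|move=> y; apply: kE].
(* dh c is negative on the radical K of h c, so K has neither a positive part
   nor a radical for dh c. *)
have e'0 : size e' = 0%N.
  case: e' eK' oe' {ef' sz'} => // x e' xK /(_ 0%N 0%N isT isT) /= dx.
  have xK' : x \in K by apply: (subvP xK); rewrite memv_span ?mem_head.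
  have x0 : x != 0.
    by apply/eqP => x0; move/eqP: dx; rewrite x0 herm0l // eq_sym oner_eq0.
  by have := ker_neg x xK' x0; rewrite dx ltr10.
have K'0 : \dim K' = 0%N.
  apply/eqP; rewrite dimv_eq0; apply: contraT => K'0.
  have := ker_neg (vpick K') (subvP KK' _ (memv_pick K')).
  by rewrite vpick0 kK' ?memv_pick // ?ltxx ?(subvP KK') ?memv_pick // => /(_ K'0).
have df : (d <= size f + size f')%N.
  have [fe pe] := orthonormal_pos (hh c) oe.
  have := pos_nonpos_dim eE WE pe W0.
  rewrite (eqP fe) -sz -addnA leq_add2l -sz' e'0 K'0 add0n addn0.
  exact: leq_trans dW.
pose g (t : R) := f ++ [seq (t%:C%C)^-1 *: x | x <- f'].
have sg t : size (g t) = (size f + size f')%N by rewrite size_cat size_map.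
have gE t : (<<g t>> <= E)%VS.
  apply/span_subvP => x; rewrite mem_cat => /orP[xf|/mapP[y yf ->]].
    by apply: (subvP fE); rewrite memv_span.
  by apply: memvZ; apply: (subvP KE); apply: (subvP fK'); rewrite memv_span.
pose H t := fun x y => - h (c + t ^+ 2) x y.
pose r := (size f + size f')%N.
have cplx (t : R) (tC := t%:C%C : C) : 0 < t /\ t <= 1 ->
  [/\ 0 < tC, tC != 0, `|(t ^+ 2)%:C%C : C| <= 1, `|(t ^+ 2)%:C%C : C| = tC ^+ 2
    & (tC^* = tC) /\ (`|t|%:C%C = tC)].
  case=> t0 t1; have t2 : `|(t ^+ 2)%:C%C : C| = tC ^+ 2.
    by rewrite normC_real ger0_norm ?sqr_ge0 // rmorphXn.
  have tC0 : 0 < tC by rewrite (ltcR 0).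
  split; rewrite ?gt_eqF ?t2 //.
    by rewrite -rmorphXn (lecR _ 1) expr_le1 // ltW.
  by rewrite conj_Creal ?ger0_real ?(ltW tC0) // gtr0_norm.
have [|eps eps0 heps] := @small_family r
   (fun i j t => `|H t (g t)`_i (g t)`_j - (i == j)%:R|) (fun t => 0 < t /\ t <= 1).
  move=> i j.
  have gl t (k : 'I_r) : (k < size f)%N -> (g t)`_k = f`_k.
    by move=> kf; rewrite nth_cat kf.
  have gr t (k : 'I_r) : (size f <= k)%N -> (g t)`_k = (t%:C%C)^-1 *: f'`_(k - size f).
    move=> kf; rewrite nth_cat ltnNge kf (nth_map 0) //.
    by rewrite ltn_subLR // ltn_ord.
  have szf' (k : 'I_r) : (size f <= k)%N -> (k - size f < size f')%N.
    by move=> kf; rewrite ltn_subLR // ltn_ord.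
  have tsq t : (c + t ^+ 2)%:C%C = c%:C%C + (t ^+ 2)%:C%C :> C by rewrite rmorphD.
  have fin (k : 'I_r) : (k < size f)%N -> f`_k \in E.
    by move=> kf; apply: (subvP fE); rewrite memv_span ?mem_nth.
  have f'in (k : 'I_r) : (size f <= k)%N -> f'`_(k - size f) \in K.
    by move=> kf; apply: (subvP fK'); rewrite memv_span ?mem_nth ?szf'.
  have shrink t M : 0 < t /\ t <= 1 -> 0 <= M ->
      M * `|(t ^+ 2)%:C%C : C| <= M * `|t|%:C%C.
    move=> t01 M0; have [tC0 _ t2 t2E [_ tE]] := cplx t t01.
    rewrite t2E tE ler_wpM2l // expr2 ler_piMr ?(ltW tC0) // (lecR _ 1).
    by case: t01.
  case: (ltnP i (size f)) => fi; case: (ltnP j (size f)) => fj.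
  - have [p [hp _]] := hpoly f`_i f`_j.
    have [M M0 hM] := horner_lipschitz p c%:C%C.
    exists M => // t t01; have [tC0 _ t2 t2E [_ tE]] := cplx t t01.
    rewrite /H !gl // -(ofm i j) //= opprK addrC -normrN opprB !hp tsq.
    exact: le_trans (hM _ t2) (shrink _ _ t01 M0).
  - have [p [hp _]] := hpoly f`_i f'`_(j - size f).
    have [M M0 hM] := horner_lipschitz p c%:C%C.
    exists M => // t t01; have [tC0 tCn t2 t2E [tc tE]] := cplx t t01.
    have pc : p.[c%:C%C] = 0.
      by rewrite -hp (herm_conj (hh c) f'`_(j - size f)) kE ?conjC0 ?fin ?f'in.
    rewrite /H gl // gr // hermZr // fmorphV /= tc -val_eqE /= ltn_eqF ?(leq_trans fi fj) // subr0.
    rewrite normrN normrM normfV (gtr0_norm tC0) ler_pdivrMl // tE mulrCA -expr2 -t2E.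
    by rewrite hp tsq -[X in `|X|]subr0 -pc; apply: hM.
  - have [p [hp _]] := hpoly f'`_(i - size f) f`_j.
    have [M M0 hM] := horner_lipschitz p c%:C%C.
    exists M => // t t01; have [tC0 tCn t2 t2E [tc tE]] := cplx t t01.
    have pc : p.[c%:C%C] = 0 by rewrite -hp kE ?fin ?f'in.
    rewrite /H gr // gl // hermZl // -val_eqE /= gtn_eqF ?(leq_trans fj fi) // subr0.
    rewrite normrN normrM normfV (gtr0_norm tC0) ler_pdivrMl // tE mulrCA -expr2 -t2E.
    by rewrite hp tsq -[X in `|X|]subr0 -pc; apply: hM.
  - have [p [hp dp]] := hpoly f'`_(i - size f) f'`_(j - size f).
    have [M M0 hM] := horner_taylor1 p c%:C%C.
    exists M => // t t01; have [tC0 tCn t2 t2E [tc tE]] := cplx t t01.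
    have pc : p.[c%:C%C] = 0.
      by rewrite -hp kE ?f'in // (subvP KE) ?f'in.
    apply: le_trans (shrink _ _ t01 M0).
    have := hM _ t2; rewrite pc subr0 -dp -tsq -hp.
    have := of' _ _ (szf' i fi) (szf' j fj).
    rewrite -(eqn_add2r (size f)) !subnK // val_eqE => /(canRL (@opprK _)) ->.
    rewrite /H !gr // hermZl // hermZr // fmorphV /= tc mulrN opprK.
    set y := h _ _ _ => le.
    have -> : - (t%:C%C^-1 * (t%:C%C^-1 * y)) - (i == j)%:R =
       - (t%:C%C ^- 2 * (y + (t ^+ 2)%:C%C * (i == j)%:R)).
      rewrite rmorphXn mulrDr mulKf ?expf_neq0 // opprD mulrA -invfM -expr2 //.
    rewrite normrN normrM normfV (ger0_norm (exprn_ge0 _ (ltW tC0))).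
    by rewrite ler_pdivrMl ?exprn_gt0 // mulrCA -{1}t2E -expr2.
pose eps' := Num.min 1 eps.
exists (eps' ^+ 2); first by rewrite exprn_gt0 // lt_min ltr01.
move=> s cs sc; pose t := Num.sqrt (s - c).
have st : s = c + t ^+ 2 by rewrite sqr_sqrtr ?subr_ge0 ?ltW // addrC subrK.
have t0 : 0 < t by rewrite sqrtr_gt0 subr_gt0.
have : t < eps'.
  rewrite -(ltr_pXn2r (n := 2)) ?nnegrE ?ltW // ?lt_min ?ltr01 //.
  by rewrite -ltrBlDl {1}st addrC addKr in sc.
rewrite lt_min => /andP[t1 te].
have [|fg pg] := @near_orthonormal_pos _ _ (H t) (hermitianN (hh _)) (g t).
  by rewrite sg => i j; apply: heps; rewrite ?gtr0_norm ?ltW.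
exists <<g t>>%VS; split => //; last by move: fg; rewrite /free sg => /eqP ->.
move=> x xg; have [->|x0] := eqVneq x 0; first by rewrite herm0l.
by have := pg x xg x0; rewrite /H -st oppr_gt0 => /ltW.
Qed.

(** At a degenerate parameter the vanishing eigenvalues decrease, so a crossing can
only turn nonpositive directions into negative ones. The set of parameters where
a nonpositive subspace of dimension d exists is closed because its complement is
where a positive subspace of dimension > dim E - d exists, and it can be continued
to the right by the preceding lemma. *)
Lemma nonpos_dim_crossing d : nonpos_dim 0 d -> nonpos_dim 1 d.
Proof.
move=> h0; apply: (real_induction (I := fun s => nonpos_dim s d)) => //; last first.
  by move=> c c0 c1; apply: nonpos_dim_right.
move=> c c0 c1 below.
have [P [W [PE WE pP nW dPW]]] := pos_nonpos_split E (hh c).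
have [dle|ltd] := leqP d (\dim W); first by exists W.
have [e [eP oe]] := orthonormal_basis (hh c) pP.
have [dl dl0 hdl] := pos_on_nearby oe.
pose t := Num.min (c / 2) (dl / 2).
have t0 : 0 < t by rewrite lt_min !divr_gt0.
have [||W' [W'E W'0 dW']] := below (c - t).
- have : t <= c / 2 by rewrite ge_min lexx.
  by lra.
- by rewrite ltrBlDr ltrDl.
have tdl : `|- t| < dl.
  have : t <= dl / 2 by rewrite ge_min lexx orbT.
  by rewrite normrN gtr0_norm // => ?; lra.
have := pos_nonpos_dim (_ : <<e>>%VS <= E)%VS W'E (hdl _ tdl) W'0.
rewrite eP => /(_ PE); rewrite -dPW leq_add2l => dWle.
by have := leq_ltn_trans (leq_trans dW' dWle) ltd; rewrite ltnn.
Qed.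

End Crossing.

(** * Complexified endomorphisms and bilinear forms *)

Section Complexified.
Context {R : realType} {V : vectType R}.
Local Notation VC := (complexify V).
Local Notation C := R[i].
Implicit Types (T N : 'End(V)) (L : seq 'End(V)) (x y z : VC) (Q : {biscalar V}).

Lemma endCE T x : endC T x = (T x.1, T x.2).
Proof. by rewrite lfunE. Qed.

Lemma vconjK : involutive (@vconj R V).
Proof. by case=> u v; rewrite /vconj /= opprK. Qed.

Lemma vconj_endC T x : vconj (endC T x) = endC T (vconj x).
Proof. by rewrite !endCE /vconj /= linearN. Qed.

Lemma bilinC_linear_l Q (c : C) x y z :
  bilinC Q (c *: x + y) z = c * bilinC Q x z + bilinC Q y z.
Proof.
case: c x y z => c d [x x'] [y y'] [z z']; rewrite /bilinC /=.
rewrite !(linearDl, linearNl, linearZl_LR) /=.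
by apply/eqP; rewrite eq_complex /=; apply/andP; split; apply/eqP; ring.
Qed.

Lemma bilinC0l Q z : bilinC Q 0 z = 0.
Proof. by have := bilinC_linear_l Q (-1) 0 0 z; rewrite scaler0 addr0 mulN1r addNr. Qed.

Lemma bilinC_linear_r Q (c : C) x y z :
  bilinC Q z (c *: x + y) = c * bilinC Q z x + bilinC Q z y.
Proof.
case: c x y z => c d [x x'] [y y'] [z z']; rewrite /bilinC /=.
rewrite !(linearDr, linearNr, linearZr_LR) /=.
by apply/eqP; rewrite eq_complex /=; apply/andP; split; apply/eqP; ring.
Qed.

Lemma bilinCZr Q (c : C) y z : bilinC Q z (c *: y) = c * bilinC Q z y.
Proof.
have b0 : bilinC Q z 0 = 0.
  by have := bilinC_linear_r Q (-1) 0 0 z; rewrite scaler0 addr0 mulN1r addNr.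
by rewrite -[c *: y]addr0 bilinC_linear_r b0 addr0.
Qed.

Lemma bilinCBr Q x y z : bilinC Q z (x - y) = bilinC Q z x - bilinC Q z y.
Proof. by rewrite -scaleN1r addrC bilinC_linear_r mulN1r addrC. Qed.

Lemma endC_sub T T' x : endC (T - T') x = endC T x - endC T' x.
Proof. by rewrite !endCE; congr pair => /=; rewrite !lfunE /= !lfunE. Qed.

Lemma bilinC_conj Q x y : bilinC Q (vconj x) (vconj y) = (bilinC Q x y)^*.
Proof.
case: x y => [x x'] [y y']; rewrite /bilinC /= !(linearNl, linearNr) /=.
by apply/eqP; rewrite eq_complex /=; apply/andP; split; apply/eqP; ring.
Qed.

Definition compC L x : VC := foldr (fun T y => endC T y) x L.

Lemma compC_cat L L' x : compC (L ++ L') x = compC L (compC L' x).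
Proof. exact: foldr_cat. Qed.

Lemma compC_linear L (c : C) x y : compC L (c *: x + y) = c *: compC L x + compC L y.
Proof. by elim: L => //= T L ->; rewrite linearP. Qed.

Lemma compC0 L : compC L 0 = 0.
Proof. by elim: L => //= T L ->; rewrite linear0. Qed.

Lemma compCZ L (c : C) x : compC L (c *: x) = c *: compC L x.
Proof. by rewrite -[c *: x]addr0 compC_linear compC0 addr0. Qed.

Lemma compCB L x y : compC L (x - y) = compC L x - compC L y.
Proof. by rewrite -scaleN1r addrC compC_linear scaleN1r addrC. Qed.

Lemma vconj_compC L x : vconj (compC L x) = compC L (vconj x).
Proof. by elim: L => //= T L <-; rewrite vconj_endC. Qed.

Lemma endC_big (I : Type) (r : seq I) (T : I -> 'End(V)) x :
  endC (\big[@comp_lfun _ _ _ _ / \1%VF]_(i <- r) T i) x = compC [seq T i | i <- r] x.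
Proof.
elim: r => [|i r IH]; first by rewrite big_nil endCE !lfunE /=; case: x.
by rewrite big_cons /= -IH !endCE /= !lfunE.
Qed.

Lemma endC_comp_exp N l x : endC (comp_exp N l) x = compC (nseq l N) x.
Proof.
rewrite /comp_exp endC_big; congr (compC _ x).
rewrite (_ : [seq N | _ <- _] = nseq (size (index_enum 'I_l)) N).
  by rewrite -[index_enum _]enumT -cardT card_ord.
by elim: (index_enum _) => //= ? ? ->.
Qed.

End Complexified.

(** * Direct sums indexed by sequences *)

Section DirectSums.
Context {K : fieldType} {E : vectType K} {I : eqType}.
Implicit Types (W : I -> {vspace E}) (U : {vspace E}) (s t : seq I).

(** The components form one function of the index, total on I, so that they can be
reindexed. *)
Lemma memv_sum_seq W s x : uniq s -> x \in (\sum_(i <- s) W i)%VS ->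
  exists f, (forall i, f i \in W i) /\ x = \sum_(i <- s) f i.
Proof.
elim: s x => [|i s IH] x /=.
  rewrite !big_nil memv0 => _ /eqP ->; exists (fun=> 0); rewrite big_nil.
  by split=> // i; apply: mem0v.
case/andP=> iNs us; rewrite big_cons => /memv_addP[y yW [z /(IH _ us)[f [fW ->]] ->]].
exists (fun j => if j == i then y else f j); split.
  by move=> j; case: eqP => [->|].
rewrite big_cons eqxx; congr (_ + _); apply: eq_big_seq => j js.
by case: eqP iNs => // <-; rewrite js.
Qed.

Lemma memv_sumr_seq W s f : (forall i, f i \in W i) ->
  \sum_(i <- s) f i \in (\sum_(i <- s) W i)%VS.
Proof.
move=> fW; elim: s => [|i s IH]; first by rewrite !big_nil mem0v.
by rewrite !big_cons memv_add.
Qed.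

Lemma directv_seq_indep W s f : uniq s -> directv (\sum_(i <- s) W i)%VS ->
  (forall i, f i \in W i) -> \sum_(i <- s) f i = 0 -> forall i, i \in s -> f i = 0.
Proof.
move=> us ds fW; have {ds} : \dim (\sum_(i <- s) W i) = (\sum_(i <- s) \dim (W i))%N.
  exact: (directvP ds).
elim: s us => [|j s IH] //= /andP[js us]; rewrite !big_cons => dS s0.
have le : (\dim (\sum_(i <- s) W i) <= \sum_(i <- s) \dim (W i))%N.
  elim: (s) => [|i r IHr]; first by rewrite !big_nil dimv0.
  by rewrite !big_cons (leq_trans (dimv_add_leqif _ _).1) // leq_add2l.
have dcap := dimv_sum_cap (W j) (\sum_(i <- s) W i)%VS.
rewrite dS in dcap.
have {dcap} [d1 d2] : \dim (\sum_(i <- s) W i) = (\sum_(i <- s) \dim (W i))%N /\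
    \dim (W j :&: \sum_(i <- s) W i) = 0%N.
  have arith (m1 m2 m3 m4 : nat) : (m3 + m2 + m4 = m3 + m1 -> m1 <= m2 -> m1 = m2 /\ m4 = 0)%N.
    by lia.
  exact: arith dcap le.
have fj : f j = 0.
  apply/eqP; rewrite -memv0 -(eqP (_ : (W j :&: \sum_(i <- s) W i)%VS == 0%VS)); last first.
    by rewrite -dimv_eq0 d2.
  rewrite memv_cap fW /=.
  by move/eqP: s0; rewrite addr_eq0 => /eqP ->; rewrite memvN; apply: memv_sumr_seq.
move=> i; rewrite inE => /orP[/eqP -> //|]; apply: IH => //.
by move: s0; rewrite fj add0r.
Qed.

(** A vanishing sum over any duplicate-free t, not only over the sequence that
witnesses the direct sum: indices outside that sequence have zero summands. *)
Lemma direct_sum_indep W U t f : is_direct_sum W U -> uniq t ->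
  (forall i, f i \in W i) -> \sum_(i <- t) f i = 0 -> forall i, i \in t -> f i = 0.
Proof.
case=> s [us W0 ds _] ut fW sum0.
have f0 i : i \notin s -> f i = 0.
  by move=> /W0 Wi; apply/eqP; rewrite -memv0 -Wi.
pose g i := if i \in t then f i else 0.
have gs : forall i, i \in s -> g i = 0.
  apply: (directv_seq_indep us ds) => [i|]; first by rewrite /g; case: ifP => // _; apply: mem0v.
  rewrite -big_mkcond -big_filter (perm_big [seq i <- t | i \in s]) /=; last first.
    by apply: uniq_perm; rewrite ?filter_uniq // => i; rewrite !mem_filter andbC.
  rewrite big_filter -[RHS]sum0 [RHS](bigID (mem s)) /= [X in _ = _ + X]big1 ?addr0 //.
move=> i it; have [/gs|/f0 //] := boolP (i \in s).
by rewrite /g it.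
Qed.

Lemma direct_sum_sub W U i : is_direct_sum W U -> (W i <= U)%VS.
Proof.
case=> s [us W0 _ <-]; have [si|/W0 ->] := boolP (i \in s); last exact: sub0v.
by rewrite (big_rem i) //= addvSl.
Qed.

Lemma direct_sum_decomp W U x : is_direct_sum W U -> x \in U ->
  exists t f, [/\ uniq t, forall i, f i \in W i & x = \sum_(i <- t) f i].
Proof.
case=> s [us _ _ <-] /(memv_sum_seq us)[f [fW ->]]; by exists s, f.
Qed.

End DirectSums.

(** * Hodge-Lefschetz modules *)

Section HodgeLefschetz.
Context {R : realType} {V : vectType R}.
Local Notation VC := (complexify V).
Local Notation C := R[i].
Variables (gr : int -> {vspace V}) (Q : {biscalar V}) (a : {vspace 'End(V)}).
Variables (N0 : 'End(V)) (k : nat) (H : int -> int -> {vspace VC}).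
Hypothesis HL : polarized_hodge_lefschetz gr Q a N0 k H.
Implicit Types (T B : 'End(V)) (L : seq 'End(V)) (x y z u v : VC) (p q e : int).

Local Notation all_in_a := (all [in a]).

Lemma endC_comm T T' x : T \in a -> T' \in a -> endC T (endC T' x) = endC T' (endC T x).
Proof.
move=> Ta T'a; have /lfunP cm := phl_abelian HL Ta T'a.
by rewrite !endCE /= -!comp_lfunE !cm.
Qed.

Lemma endC_compC T L x : T \in a -> all_in_a L -> endC T (compC L x) = compC L (endC T x).
Proof.
move=> Ta; elim: L => //= T' L IH /andP[T'a La].
by rewrite endC_comm // IH.
Qed.

Lemma compC_catC L L' x : all_in_a L -> all_in_a L' -> compC (L ++ L') x = compC (L' ++ L) x.
Proof.
elim: L => [|T L IH] /=; first by rewrite cats0.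
case/andP=> Ta La L'a; rewrite IH // !compC_cat endC_compC // compC_cat.
Qed.

Lemma compC_perm L L' x : perm_eq L L' -> all_in_a L -> compC L x = compC L' x.
Proof.
move=> LL' La; suff [_ ->] : all_in_a L' /\ compC L' x = compC L x by [].
apply: (@catCA_perm_ind _ (fun M => all_in_a M /\ compC M x = compC L x) _ L L' LL') => //.
move=> s1 s2 s3 []; rewrite !all_cat => /and3P[s1a s2a s3a] <-; rewrite s1a s2a s3a.
by split=> //; rewrite !compC_cat -[LHS]compC_cat compC_catC // compC_cat.
Qed.

Lemma bilinC_endC T x y : T \in a -> bilinC Q (endC T x) y = - bilinC Q x (endC T y).
Proof.
move=> Ta; have inv (u v : V) : Q (T u) v = - Q u (T v).
  by apply/eqP; rewrite -addr_eq0 (phl_inf_aut HL Ta).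
rewrite !endCE /bilinC /= !inv.
by apply/eqP; rewrite eq_complex /=; apply/andP; split; apply/eqP; ring.
Qed.

Lemma bilinC_compC L x y : all_in_a L ->
  bilinC Q (compC L x) y = (-1) ^+ size L * bilinC Q x (compC L y).
Proof.
elim: L y => [|T L IH] y /=; first by rewrite mul1r.
by case/andP=> Ta La; rewrite bilinC_endC // IH // -endC_compC // exprS -mulrA mulN1r.
Qed.

Lemma bilinC_sym x y : bilinC Q y x = (-1) ^+ k * bilinC Q x y.
Proof.
have par (u v : V) : Q u v = (-1) ^+ k * Q v u.
  by rewrite (phl_parity HL (memvf u) (memvf v)).
have -> : (-1) ^+ k = ((-1) ^+ k)%:C%C :> C by rewrite rmorphXn rmorphN1.
rewrite /bilinC [Q y.1 x.1]par [Q y.2 x.2]par [Q y.1 x.2]par [Q y.2 x.1]par.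
by apply/eqP; rewrite eq_complex /=; apply/andP; split; apply/eqP; ring.
Qed.

(** For L of length m and p + q = k + m this is, on V^{p,q} with e = p - q, the form
of the Hodge-Riemann relations attached to the product of L. *)
Definition hform e L x y : C := 'i%C ^ e * bilinC Q x (compC L (vconj y)).

Lemma i_unit : ('i%C : C) != 0.
Proof. by rewrite eq_complex /= oner_eq0 andbF. Qed.

Lemma i_sqr : ('i%C : C) ^+ 2 = -1.
Proof. by apply/eqP; rewrite expr2 eq_complex /=; apply/andP; split; apply/eqP; ring. Qed.

Lemma i_conj : ('i%C : C)^* = 'i%C^-1.
Proof.
apply: (mulfI i_unit); rewrite divff ?i_unit //.
by apply/eqP; rewrite eq_complex /=; apply/andP; split; apply/eqP; ring.
Qed.

(** Exchanging the arguments produces the sign (-1)^k from the parity of Q and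
(-1)^m from moving the m factors of L across Q; conjugating i^(p-q) produces
(-1)^(p-q), and the signs cancel because p + q = k + m. *)
Lemma hform_hermitian p q L : p + q = k%:Z + (size L)%:Z -> all_in_a L ->
  is_hermitian (hform (p - q) L).
Proof.
move=> pq La; split=> [c x y z|x y]; first by rewrite /hform bilinC_linear_l mulrDr mulrCA.
rewrite /hform rmorphM /= -bilinC_conj vconj_compC vconjK [in RHS]bilinC_sym bilinC_compC //.
rewrite (mulrA ((-1) ^+ k)) -exprD mulrA; congr (_ * _).
have -> : ('i%C ^ (p - q))^* = 'i%C ^ (q - p) :> C.
  have -> : q - p = - (p - q) by rewrite opprB.
  by rewrite fmorphXz /= i_conj exprz_inv.
have -> : p - q = (q - p) + 2%:Z * (p - q) by lia.
rewrite expfzDr ?i_unit // -exprz_exp; congr (_ * _).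
have -> : 'i%C ^ 2%:Z = -1 :> C by rewrite -exprnP i_sqr.
have -> : p - q = (k + size L)%:Z - 2%:Z * q by lia.
rewrite expfzDr ?oppr_eq0 ?oner_eq0 // -mulrN -exprz_exp.
by rewrite -[(-1) ^ 2%:Z]/((-1) ^+ 2) sqrrN expr1n exp1rz mulr1.
Qed.

Lemma H_shift T p q x : T \in a -> x \in H p q -> endC T x \in H (p - 1) (q - 1).
Proof. by move=> Ta xH; apply: (subvP (phl_shift HL Ta p q)); apply: memv_img. Qed.

Lemma H_compC L p q x : all_in_a L -> x \in H p q ->
  compC L x \in H (p - (size L)%:Z) (q - (size L)%:Z).
Proof.
elim: L => [|T L IH] /=; first by rewrite !subr0.
case/andP=> Ta La xH; have := H_shift Ta (IH La xH).
have e l : l - (size L).+1%:Z = l - (size L)%:Z - 1 by lia.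
by rewrite !e.
Qed.

Lemma H_gr p q l : p + q = k%:Z + l -> (H p q <= subspaceC (gr l))%VS.
Proof.
move=> pq; have -> : q = k%:Z + l - p by rewrite -pq addrC addKr.
exact: (direct_sum_sub p (phl_hodge HL l).1).
Qed.

(** Beyond level k one of p, q exceeds k. *)
Lemma H_big p q (m : nat) : p + q = k%:Z + m%:Z -> (k < m)%N -> H p q = 0%VS.
Proof. by move=> pq km; apply: (phl_range HL); apply/negP; lia. Qed.

Lemma lefschetz_inj T (m : nat) x : lefschetz gr T -> x \in subspaceC (gr m%:Z) ->
  compC (nseq m T) x = 0 -> x = 0.
Proof.
case=> _ /(_ m)[inj _]; rewrite mem_subspaceC -endC_comp_exp endCE => /andP[x1 x2] [] f1 f2.
case: x x1 x2 f1 f2 => x x' /= xg xg' f1 f2.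
have -> : x = 0 by apply: inj; rewrite ?mem0v ?linear0.
by have -> : x' = 0 by apply: inj; rewrite ?mem0v ?linear0.
Qed.

Lemma endC_inj T p q (m : nat) x : lefschetz gr T -> p + q = k%:Z + m.+1%:Z ->
  x \in H p q -> endC T x = 0 -> x = 0.
Proof.
move=> lef pq xH Tx; apply: (lefschetz_inj (m := m.+1) lef).
  by apply: (subvP (H_gr pq)).
by rewrite -[m.+1]addn1 nseqD compC_cat /= Tx compC0.
Qed.

(** The hard Lefschetz isomorphism between the graded pieces respects types. Write y
as the image of some x in (V_m)_C: the components of x of type other than (p, q)
map to components of y of the wrong type, so they contribute nothing. *)
Lemma N0_surj p q (m : nat) y : p + q = k%:Z + m%:Z ->
  y \in H (p - m%:Z) (q - m%:Z) -> exists2 x, x \in H p q & y = compC (nseq m N0) x.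
Proof.
move=> pq yH.
have [x xg yx] : exists2 x, x \in subspaceC (gr m) & y = compC (nseq m N0) x.
  have : y \in subspaceC (gr (- m%:Z)) by apply: (subvP (H_gr _)) yH; lia.
  rewrite mem_subspaceC -((phl_lefschetz HL).2 m).2.
  case/andP=> /memv_imgP[u ug y1] /memv_imgP[u' u'g y2].
  exists (u, u'); first by rewrite mem_subspaceC /= ug.
  by rewrite -endC_comp_exp endCE /= -y1 -y2; case: (y).
have [t [f [ut fH xf]]] := direct_sum_decomp (phl_hodge HL m).1 xg.
have dn : forall l : int, k%:Z + m%:Z - l - m%:Z = k%:Z - m%:Z - (l - m%:Z) by move=> l; lia.
have qE : k%:Z + m%:Z - p = q by lia.
(* p is added to the index list so that y has a slot even if the component of
   x of type (p, q) is not listed. *)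
pose s := undup (p :: t).
pose z l := compC (nseq m N0) (if l \in t then f l else 0) - (if l == p then y else 0).
have N0a : all_in_a (nseq m N0) by rewrite all_nseq (phl_N0 HL) orbT.
have appH l x' : x' \in H l (k%:Z + m%:Z - l) ->
    compC (nseq m N0) x' \in H (l - m%:Z) (k%:Z - m%:Z - (l - m%:Z)).
  by move=> /(H_compC N0a); rewrite size_nseq dn.
have zH l : z (l + m%:Z) \in H l (k%:Z - m%:Z - l).
  rewrite memvB //.
    rewrite -{3 4}[l](addrK m%:Z); apply: appH; case: ifP => // _; exact: mem0v.
  case: eqP => [lp|_]; last exact: mem0v.
  have -> : l = p - m%:Z by lia.
  by rewrite -dn qE.
have app_sum I (r : seq I) (g : I -> VC) L :
    compC L (\sum_(i <- r) g i) = \sum_(i <- r) compC L (g i).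
  elim: r => [|i r IH]; first by rewrite !big_nil compC0.
  by rewrite !big_cons -IH -[g i]scale1r compC_linear !scale1r.
have ds := (phl_hodge HL (- m%:Z)).1.
have z0 := direct_sum_indep (t := [seq l - m%:Z | l <- s]) ds _ zH.
have {}z0 : z p = 0.
  rewrite -[p](subrK m%:Z); apply: z0.
  - by rewrite map_inj_uniq ?undup_uniq //; apply: addIr.
  - rewrite big_map; under eq_bigr do rewrite subrK.
    rewrite sumrB -app_sum -big_mkcond /= -big_filter.
    rewrite (perm_big t) /=; last first.
      apply: uniq_perm; rewrite ?filter_uniq ?undup_uniq // => l.
      by rewrite mem_filter mem_undup inE; case: (l \in t); rewrite ?orbT.
    rewrite -xf -yx (bigD1_seq p) ?undup_uniq ?mem_undup ?mem_head //= eqxx.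
    by rewrite big1 ?addr0 ?subrr // => l /negPf ->.
  - by apply: map_f; rewrite mem_undup mem_head.
exists (if p \in t then f p else 0).
  by case: ifP => _; [rewrite -qE; apply: fH | apply: mem0v].
by move/eqP: z0; rewrite /z eqxx subr_eq0 => /eqP.
Qed.

(** V^{p,q} is the sum of its primitive part and N0 V^{p+1,q+1}: N0^(m+1) x has the
right type to be N0^(m+2) y with y in V^{p+1,q+1}. *)
Lemma prim_decomp p q (m : nat) x : p + q = k%:Z + m%:Z -> x \in H p q ->
  exists2 y, y \in H (p + 1) (q + 1) & compC (nseq m.+1 N0) (x - endC N0 y) = 0.
Proof.
move=> pq xH; have N0a n : all_in_a (nseq n N0) by rewrite all_nseq (phl_N0 HL) orbT.
have pq2 : (p + 1) + (q + 1) = k%:Z + m.+2%:Z by lia.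
have [|y yH e] := N0_surj (y := compC (nseq m.+1 N0) x) pq2.
  have := H_compC (N0a m.+1) xH; rewrite size_nseq.
  have e l : l + 1 - m.+2%:Z = l - m.+1%:Z by lia.
  by rewrite !e.
exists y => //; rewrite -scaleN1r addrC compC_linear scaleN1r e.
by rewrite -[m.+2]addn1 nseqD compC_cat addNr.
Qed.

(** This is the polarization of the primitive part, after
(-1)^p i^-(k+m) = i^(2p-(p+q)). *)
Lemma prim_pos p q (m : nat) x : p + q = k%:Z + m%:Z -> x \in H p q ->
  compC (nseq m.+1 N0) x = 0 -> x != 0 -> 0 < hform (p - q) (nseq m N0) x x.
Proof.
move=> pq xH x0 xn0; have [_ [_ _ pos]] := phl_polarized HL m.
have := pos p x; rewrite /= {pos}.
have -> : k%:Z + m%:Z - p = q by lia.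
have -> : x \in (H p q :&: subspaceC (primitive gr N0 m))%VS.
  rewrite memv_cap xH mem_subspaceC !memv_cap !memv_ker.
  have := subvP (H_gr pq) x xH; rewrite mem_subspaceC => /andP[-> ->] /=.
  by move: x0; rewrite -endC_comp_exp endCE => -[-> ->]; rewrite eqxx.
move=> /(_ isT xn0); rewrite /herm_form mulrA.
have -> : ((-1) ^ p * 'i%C ^ (- (k%:Z + m%:Z)))%R = 'i%C ^ (p - q) :> C.
  rewrite -i_sqr exprnP exprz_exp -expfzDr ?i_unit //; congr (_ ^ _); lia.
rewrite /hform -endC_comp_exp endCE.
by [].
Qed.

Lemma hform_perm e L L' : perm_eq L L' -> all_in_a L -> hform e L = hform e L'.
Proof.
by move=> LL' La; apply: funext => x; apply: funext => y; rewrite /hform (compC_perm _ LL').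
Qed.

Lemma hform_catCA e L1 L2 L3 : all_in_a L1 -> all_in_a L2 -> all_in_a L3 ->
  hform e (L1 ++ L2 ++ L3) = hform e (L2 ++ L1 ++ L3).
Proof.
move=> L1a L2a L3a; apply: hform_perm; last by rewrite !all_cat L1a L2a.
by rewrite (perm_catCA L1 L2 L3).
Qed.

Lemma hform_compCl e L x y : all_in_a L ->
  hform e L x y = (-1) ^+ size L * ('i%C ^ e * bilinC Q (compC L x) (vconj y)).
Proof.
move=> La; rewrite bilinC_compC // [_ ^ e * _]mulrCA (mulrA ((-1) ^+ size L)).
by rewrite -exprD -signr_odd addnn odd_double mul1r.
Qed.

(** The sign is the reason for which signatures alternate from one level to the
next: multiplication by B sends positive vectors at level m + 2 to negative ones
at level m. *)
Lemma hform_endC e B L x y : B \in a -> all_in_a L ->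
  hform e L (endC B x) (endC B y) = - hform e (B :: B :: L) x y.
Proof.
by move=> Ba La; rewrite /hform bilinC_endC // vconj_endC -endC_compC // mulrN.
Qed.

Lemma hform_endCr e B L x y : B \in a -> all_in_a L ->
  hform e L x (endC B y) = hform e (B :: L) x y.
Proof. by move=> Ba La; rewrite /hform vconj_endC -endC_compC. Qed.

(** The image under B of a maximal positive subspace at level m + 2. Its dimension is
the expected negative index at level m, so it is a lower bound for that index
which needs no knowledge of the form at level m. *)
Lemma neg_image B L p q b : B \in a -> lefschetz gr B -> all_in_a L ->
  p + q = k%:Z + (size L)%:Z ->
  has_neg_index (hform (p - q) (B :: B :: L)) (H (p + 1) (q + 1)) b ->
  exists N, [/\ (N <= H p q)%VS, (N <= endC B @: H (p + 1)%R (q + 1)%R)%VS,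
    pos_on (fun x y => - hform (p - q) L x y) N
  & (\dim N + b = \dim (H (p + 1) (q + 1)))%N].
Proof.
move=> Ba Bl La pq [P [N [PE NE pP nN [dN dE]]]].
have pq2 : (p + 1) + (q + 1) = k%:Z + (size L).+2%:Z by lia.
have inj x : x \in H (p + 1) (q + 1) -> endC B x = 0 -> x = 0.
  exact: endC_inj Bl pq2.
exists (endC B @: P)%VS; split.
- apply/subvP => y /memv_imgP[x xP ->].
  have := H_shift Ba (subvP PE x xP); by rewrite !addrK.
- exact: limgS.
- move=> y /memv_imgP[x xP ->] Bx; rewrite hform_endC // opprK.
  by apply: pP => //; apply: contraNneq Bx => ->; rewrite linear0.
- rewrite limg_dim_eq //; apply/eqP; rewrite -subv0; apply/subvP => x.
  rewrite memv_cap memv0 memv_ker => /andP[xP /eqP Bx].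
  by apply/eqP; apply: inj => //; apply: (subvP PE).
Qed.

(** The negative index on V^{p,q} predicted by the Lefschetz decomposition, namely
dim V^{p+1,q+1} - dim V^{p+2,q+2} + dim V^{p+3,q+3} - ..., cut after n terms; the
remaining ones vanish as soon as k < m + 2 n, where p + q = k + m. *)
Fixpoint negdim n p q : nat :=
  if n is n'.+1 then \dim (H (p + 1) (q + 1)) - negdim n' (p + 1) (q + 1) else 0.
Arguments negdim : simpl never.

Lemma negdimS n p q :
  negdim n.+1 p q = (\dim (H (p + 1) (q + 1)) - negdim n (p + 1) (q + 1))%N.
Proof. by []. Qed.

(** The Hodge-Riemann relations for powers of N0. On
V^{p,q} = primitive part + N0 V^{p+1,q+1}, an orthogonal sum, the form is positive
on the first summand and minus the form of the next level on the second. *)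
Lemma neg_index_N0 p q (m n : nat) :
  p + q = k%:Z + m%:Z -> (k < m + n.*2)%N ->
  has_neg_index (hform (p - q) (nseq m N0)) (H p q) (negdim n p q).
Proof.
have N0a j : all_in_a (nseq j N0) by rewrite all_nseq (phl_N0 HL) orbT.
elim: n p q m => [|n IH] p q m pq km.
  by apply: neg_index0; apply: (H_big pq); rewrite addn0 in km.
have pq2 : (p + 1) + (q + 1) = k%:Z + m.+2%:Z by lia.
have km2 : (k < m.+2 + n.*2)%N by rewrite doubleS !addnS in km; rewrite !addSn.
have e2 : (p + 1) - (q + 1) = p - q by lia.
have pqs : p + q = k%:Z + (size (nseq m N0))%:Z by rewrite size_nseq.
have hh := hform_hermitian pqs (N0a m).
have := IH _ _ _ pq2 km2; rewrite e2 => sg.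
have N0in := phl_N0 HL; have lef := phl_lefschetz HL.
have [N [NE _ nN dN]] := neg_image N0in lef (N0a m) pqs sg.
have [P' [N' [P'E N'E pP' nN' [dN' dE']]]] := sg.
pose E2 := H (p + 1) (q + 1).
pose prim := (H p q :&: lker (endC (comp_exp N0 m.+1)))%VS.
have primE x : (x \in prim) = (x \in H p q) && (compC (nseq m.+1 N0) x == 0).
  by rewrite memv_cap memv_ker endC_comp_exp.
have inj2 y : y \in E2 -> compC (nseq m.+1 N0) (endC N0 y) = 0 -> y = 0.
  move=> yE e0; apply: (lefschetz_inj (m := m.+2) lef); first exact: (subvP (H_gr pq2)).
  by rewrite -[m.+2]addn1 nseqD compC_cat.
have capE : (prim :&: (endC N0 @: E2))%VS = 0%VS.
  apply/eqP; rewrite -subv0; apply/subvP => x; rewrite memv_cap memv0 primE.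
  case/andP=> /andP[_ /eqP x0] /memv_imgP[y yE xy].
  by rewrite xy (inj2 y) ?linear0 // -xy.
have imgE U : (U <= E2)%VS -> \dim (endC N0 @: U) = \dim U.
  move=> UE; rewrite limg_dim_eq //; apply/eqP; rewrite -subv0; apply/subvP => x.
  rewrite memv_cap memv0 memv_ker => /andP[xU /eqP x0].
  by apply/eqP; apply: inj2; rewrite ?(subvP UE) // x0 compC0.
have imgH U : (U <= E2)%VS -> (endC N0 @: U <= H p q)%VS.
  move=> UE; apply/subvP => y /memv_imgP[x xU ->].
  by have := H_shift N0in (subvP UE x xU); rewrite !addrK.
have dH : \dim (H p q) = (\dim prim + \dim E2)%N.
  rewrite -(imgE E2) // -dimv_disjoint_sum //; congr (\dim _).
  apply/eqP; rewrite eqEsubv; apply/andP; split; last first.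
    by rewrite subv_add capvSl imgH.
  apply/subvP => x xH; have [y yE x0] := prim_decomp pq xH.
  rewrite -(subrK (endC N0 y) x); apply: memv_add; last exact: memv_img.
  rewrite primE x0 eqxx andbT memvB //.
  by have := H_shift N0in yE; rewrite !addrK.
exists (prim + (endC N0 @: N'))%VS, N; split=> //.
- by rewrite subv_add capvSl imgH.
- move=> z /memv_addP[x]; rewrite primE => /andP[xH /eqP x0] [w /memv_imgP[y yN ->]] ->.
  have cross : hform (p - q) (nseq m N0) x (endC N0 y) = 0.
    rewrite hform_endCr // hform_compCl; last exact: (N0a m.+1).
    have -> : compC (N0 :: nseq m N0) x = 0 by exact: x0.
    by rewrite bilinC0l !mulr0.
  rewrite hermDl // !hermDr // cross (herm_conj hh x (endC N0 y)) cross conjC0 addr0 add0r.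
  rewrite hform_endC //; have [->|xn0] := eqVneq x 0.
    rewrite herm0l // !add0r => yn0; apply: nN' => //.
    by apply: contraNneq yn0 => ->; rewrite linear0.
  move=> _; rewrite ltr_pwDl //; first exact: prim_pos.
  have [->|yn0] := eqVneq y 0; last by apply: ltW; apply: nN'.
  by rewrite -hform_endC // linear0 herm0l.
- have dle : (negdim n (p + 1) (q + 1) <= \dim E2)%N by rewrite -dE' leq_addl.
  rewrite dimv_disjoint_sum; last first.
    apply/eqP; rewrite -subv0 -capE capvS //; exact: limgS.
  rewrite imgE // dN' dH negdimS; split; last by rewrite -addnA subnKC.
  by rewrite -dN addnK.
Qed.

(** Q pairs V^{p,q} with N0^m conj V^{p,q} nondegenerately, by the signature for
N0^m, and N0^m V^{p,q} contains the image of the product L. *)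
Lemma hform_ker p q L u : p + q = k%:Z + (size L)%:Z -> all_in_a L -> u \in H p q ->
  (forall y, y \in H p q -> hform (p - q) L u y = 0) -> compC L u = 0.
Proof.
move=> pq La uH perp; set m := size L in pq.
have N0a : all_in_a (nseq m N0) by rewrite all_nseq (phl_N0 HL) orbT.
have [z zH uz] := N0_surj pq (H_compC La uH).
have pqs : p + q = k%:Z + (size (nseq m N0))%:Z by rewrite size_nseq.
suff z0 : z = 0 by rewrite uz z0 compC0.
have km : (k < m + k.+1.*2)%N by lia.
apply: (neg_index_nondeg (hform_hermitian pqs N0a) (neg_index_N0 pq km) zH) => y yH.
move: (perp y yH); rewrite !hform_compCl // -uz => /eqP.
by rewrite mulf_eq0 signr_eq0 /= => /eqP ->; rewrite mulr0.
Qed.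

(** The image under B of a positive subspace at level m + 2 is a maximal negative
subspace N of V^{p,q} by dimension, and v is orthogonal to it because
h(v, B w) = +- i^(p-q) Q(B L v, conj w) = 0. Vectors orthogonal to N are
positive. *)
Lemma hodge_riemann_of_index p q n B L v : B \in a -> lefschetz gr B -> all_in_a L ->
  p + q = k%:Z + (size L)%:Z ->
  has_neg_index (hform (p - q) L) (H p q) (negdim n.+1 p q) ->
  has_neg_index (hform (p - q) (B :: B :: L)) (H (p + 1) (q + 1)) (negdim n (p + 1) (q + 1)) ->
  v \in H p q -> compC (B :: L) v = 0 -> v != 0 -> 0 < hform (p - q) L v v.
Proof.
move=> Ba lB La pq sg sg2 vH Bv v0.
have [N [NE NB nN dN]] := neg_image Ba lB La pq sg2.
apply: (neg_index_perp (hform_hermitian pq La) sg NE nN) => //.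
  by rewrite negdimS -dN addnK.
move=> y /(subvP NB)/memv_imgP[w wH ->].
by rewrite hform_endCr // hform_compCl /= ?Ba // [X in bilinC Q X]Bv bilinC0l !mulr0.
Qed.

Definition segment B A (s : R) : 'End(V) := s *: A + (1 - s) *: B.

Lemma endC_segment B A s x :
  endC (segment B A s) x = s%:C%C *: endC A x + (1 - s)%:C%C *: endC B x.
Proof.
rewrite !endCE; congr pair => /=; rewrite !lfunE /= !lfunE /= !scale0r.
  by rewrite !subr0.
by rewrite !addr0.
Qed.

Lemma segment_in B A s : A \in a -> B \in a -> segment B A s \in a.
Proof. by move=> Aa Ba; rewrite memvD ?memvZ. Qed.

(** The values along the segment are polynomial in s; the second family is the
derivative, where one of the l factors is replaced by the direction A - B of the
segment. Induction on l, by peeling off one factor. *)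
Lemma segment_poly B A (phi : VC -> C) l w : A \in a -> B \in a ->
  (forall c x y, phi (c *: x + y) = c * phi x + phi y) ->
  exists p : {poly C},
   (forall s, phi (compC (nseq l (segment B A s)) w) = p.[s%:C%C]) /\
   (forall s, l%:R * phi (compC ((A - B) :: nseq l.-1 (segment B A s)) w) = p^`().[s%:C%C]).
Proof.
move=> Aa Ba lin.
have linD x y : phi (x + y) = phi x + phi y by rewrite -[x]scale1r lin mul1r scale1r.
have lin0 : phi 0 = 0 by have := lin (-1) 0 0; rewrite scaler0 addr0 mulN1r addNr.
have linZ c x : phi (c *: x) = c * phi x by rewrite -[c *: x]addr0 lin lin0 addr0.
have Sa s := segment_in s Aa Ba.
have ABa : A - B \in a by rewrite memvB.
have nSa s j : all_in_a (nseq j (segment B A s)) by rewrite all_nseq Sa orbT.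
elim: l w => [|l IH] w.
  exists (phi w)%:P; split=> s; first by rewrite hornerC.
  by rewrite mul0r derivC horner0.
have [pA [pA0 pA1]] := IH (endC A w); have [pB [pB0 pB1]] := IH (endC B w).
have appS L s x : compC L (endC (segment B A s) x) =
    s%:C%C *: compC L (endC A x) + (1 - s)%:C%C *: compC L (endC B x).
  by rewrite endC_segment compC_linear compCZ.
exists ('X * pA + (1 - 'X) * pB); split=> s.
  rewrite /= endC_compC // appS lin linZ pA0 pB0 !hornerE /= rmorphB rmorph1 //.
rewrite [l.+1.-1]/= !derivE !hornerE -!pA0 -!pB0 -!pA1 -!pB1.
have step : l%:R * (s%:C%C * phi (compC ((A - B) :: nseq l.-1 (segment B A s)) (endC A w)) +
    (1 - s)%:C%C * phi (compC ((A - B) :: nseq l.-1 (segment B A s)) (endC B w))) =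
    l%:R * phi (compC ((A - B) :: nseq l (segment B A s)) w).
  case: l {IH pA0 pA1 pB0 pB1} => [|l]; first by rewrite !mul0r.
  congr (_ * _); rewrite -!linZ -linD -appS; congr phi.
  by rewrite /= -endC_compC.
have split1 : phi (compC ((A - B) :: nseq l (segment B A s)) w) =
   phi (compC (nseq l (segment B A s)) (endC A w)) -
   phi (compC (nseq l (segment B A s)) (endC B w)).
  rewrite /= endC_compC // -[X in _ = _ + X]mulN1r -linZ -linD scaleN1r -compCB.
  by rewrite endC_sub.
rewrite -[l.+1]addn1 natrD mulrDl mul1r -step split1 rmorphB rmorph1 /=.
ring.
Qed.

Variable Cone : set 'End(V).
Hypothesis HC : lefschetz_cone gr a N0 Cone.

Lemma cone_a T : Cone T -> T \in a.
Proof. by case: HC => + _ _ _; apply. Qed.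

Lemma cone_lefschetz T : Cone T -> lefschetz gr T.
Proof. by case: HC => _ _ _; apply. Qed.

Lemma cone_segment B A s : Cone A -> Cone B -> 0 <= s -> s <= 1 -> Cone (segment B A s).
Proof. by move=> CA CB s0 s1; case: HC => _ [_ cvx] _ _; apply: cvx. Qed.

(** Transport of the signature from A to B along the segment. If the vanishing
eigenvalues of the form move in the negative direction at every degenerate
parameter s < 1, then the nonpositive dimension at B (s = 0) is at most the
negative index at A (s = 1). The image of a positive subspace at the next level
shows that the negative index at B is at least this number. *)
Lemma neg_index_deform A B L (l n : nat) p q : Cone A -> Cone B -> all_in_a L ->
  p + q = k%:Z + (size L + l.+1)%:Z ->
  (forall s u, 0 <= s -> s < 1 -> u \in H p q -> u != 0 ->
     compC (L ++ nseq l.+1 (segment B A s)) u = 0 ->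
     hform (p - q) (L ++ (A - B) :: nseq l (segment B A s)) u u < 0) ->
  has_neg_index (hform (p - q) (L ++ nseq l.+1 A)) (H p q) (negdim n.+1 p q) ->
  has_neg_index (hform (p - q) (B :: B :: L ++ nseq l.+1 B)) (H (p + 1) (q + 1))
    (negdim n (p + 1) (q + 1)) ->
  has_neg_index (hform (p - q) (L ++ nseq l.+1 B)) (H p q) (negdim n.+1 p q).
Proof.
move=> CA CB La pq cross sgA sg2; have Aa := cone_a CA; have Ba := cone_a CB.
have Sa s := segment_in s Aa Ba.
have LSa j s : all_in_a (L ++ nseq j (segment B A s)).
  by rewrite all_cat La all_nseq Sa orbT.
have seg0 : segment B A 0 = B by rewrite /segment scale0r subr0 scale1r add0r.
have seg1 : segment B A 1 = A by rewrite /segment subrr scale0r scale1r addr0.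
have sz T : (size L + l.+1 = size (L ++ nseq l.+1 T))%N by rewrite size_cat size_nseq.
have kcong (i j : nat) : i = j -> k%:Z + i%:Z = k%:Z + j%:Z by move=> ->.
have hh s := hform_hermitian (etrans pq (kcong _ _ (sz _))) (LSa l.+1 s).
have LBa : all_in_a (L ++ nseq l.+1 B) by rewrite -seg0.
have pqB : p + q = k%:Z + (size (L ++ nseq l.+1 B))%:Z by rewrite -sz.
have [N [NE _ nN dN]] := neg_image Ba (cone_lefschetz CB) LBa pqB sg2.
apply: (neg_index_of_bounds _ NE nN); first by rewrite -seg0.
  by rewrite negdimS -dN addnK.
move=> W WE W0.
pose h s := hform (p - q) (L ++ nseq l.+1 (segment B A s)).
pose LD s := L ++ (A - B) :: nseq l (segment B A s).
have LDa s : all_in_a (LD s).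
  by rewrite all_cat La /= memvB // all_nseq Sa orbT.
have szD s : (size L + l.+1 = size (LD s))%N by rewrite size_cat /= size_nseq.
pose dh s x y := l.+1%:R * hform (p - q) (LD s) x y.
have dhh s : is_hermitian (dh s).
  have hD := hform_hermitian (etrans pq (kcong _ _ (szD s))) (LDa s).
  split=> [c x y z|x y]; first by rewrite /dh hermDl // hermZl // mulrDr mulrCA.
  by rewrite /dh (herm_conj hD x y) -[in LHS](@conjC_nat C l.+1) -rmorphM.
have hpoly x y : exists P : {poly C},
    (forall s, h s x y = P.[s%:C%C]) /\ (forall s, dh s x y = P^`().[s%:C%C]).
  have [||c x' y'|P [P0 P1]] := @segment_poly B A
      (fun w => 'i%C ^ (p - q) * bilinC Q x (compC L w)) l.+1 (vconj y) => //.
    by rewrite compC_linear bilinC_linear_r mulrDr mulrCA.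
  exists P; split=> s; first by rewrite -P0 /h /hform compC_cat.
  by rewrite -P1 /dh /hform compC_cat.
have crossing s : 0 <= s -> s < 1 -> forall u, u \in H p q -> u != 0 ->
    (forall y, y \in H p q -> h s u y = 0) -> dh s u u < 0.
  move=> s0 s1 u uH u0 perp; rewrite /dh pmulr_rlt0 ?ltr0Sn //.
  apply: cross => //; apply: (hform_ker _ _ uH perp) => //.
  by rewrite -sz.
have [|W' [W'E W'0 dW']] := @nonpos_dim_crossing _ _ h dh _ hh dhh hpoly crossing (\dim W).
  by exists W; rewrite /h seg0.
apply: leq_trans dW' _; apply: (neg_index_nonpos sgA W'E).
by rewrite -seg1.
Qed.

(** Induction on the number r of factors As that are not B. For r = 0 the segment
from B to N0 is never degenerate, since its powers have the Lefschetz property.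
For A :: As the segment runs from B to A, where the claim has one factor less.
At a point S of it with A As S^(l+1) u = 0, the vector A u is in the kernel of
As S^(l+1), so it is positive for As S^l at level m - 2 by the induction
hypothesis; since A - B = (A - S) / (1 - s), the derivative of the form at u is a
positive multiple of minus this value. The inner induction on n is downward on
the level. *)
Lemma neg_index_cone As B (l n : nat) p q : (forall T, T \in As -> Cone T) -> Cone B ->
  p + q = k%:Z + (size As + l)%:Z -> (k < size As + l + n.*2)%N ->
  has_neg_index (hform (p - q) (As ++ nseq l B)) (H p q) (negdim n p q).
Proof.
move: {2}(size As) (erefl (size As)) => r szA.
elim: r As B l n p q szA => [|r IHr] As B l n p q.
  move=> /size0nil -> _ CB /=; rewrite add0n.
  elim: n p q l => [|n IHn] p q l pq km.
    by apply: neg_index0; apply: (H_big pq); rewrite addn0 in km.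
  case: l pq km => [|l] pq km; first exact: (neg_index_N0 pq km).
  have CN0 : Cone N0 by case: HC.
  apply: (@neg_index_deform N0 B [::]) => //.
  - move=> s u s0 s1 uH u0 Su; case/eqP: u0.
    apply: (lefschetz_inj (cone_lefschetz (cone_segment CN0 CB s0 (ltW s1))) _ Su).
    exact: (subvP (H_gr pq)).
  - exact: (neg_index_N0 pq km).
  - have -> : p - q = (p + 1) - (q + 1) by lia.
    by apply: (IHn _ _ l.+3); lia.
case: As => [//|A As] [szA] CAs CB.
have CA : Cone A by apply: CAs; rewrite mem_head.
have CAs' T : T \in As -> Cone T by move=> TAs; apply: CAs; rewrite inE TAs orbT.
have Asa : all_in_a (A :: As) by apply/allP => T /CAs /cone_a.
have Asa' : all_in_a As by case/andP: Asa.
elim: n p q l => [|n IHn] p q l pq km.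
  by apply: neg_index0; apply: (H_big pq); rewrite addn0 in km.
have Ta : A \in a by exact: cone_a.
have nseqa j T : T \in a -> all_in_a (nseq j T) by move=> Tain; rewrite all_nseq Tain orbT.
case: l pq km => [|l] pq km.
  rewrite (@hform_catCA _ [:: A] As [::]) //= ?Ta //.
  by apply: (IHr As A 1) => //; move: pq km => /=; rewrite addn1 addn0.
apply: (@neg_index_deform A B (A :: As)) => //.
- move=> s u s0 s1 uH u0; set S := segment B A s => Su.
  have CS : Cone S by apply: cone_segment => //; apply: ltW.
  have Sa := cone_a CS; pose L := As ++ nseq l S.
  have La : all_in_a L by rewrite all_cat Asa' nseqa.
  have ABa : A - B \in a by rewrite memvB // cone_a.
  have -> : hform (p - q) ((A :: As) ++ A - B :: nseq l S) = hform (p - q) (A - B :: A :: L).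
    by rewrite (@hform_catCA _ (A :: As) [:: A - B]) //= ?ABa ?nseqa.
  have SL : compC (S :: A :: L) u = 0.
    rewrite -Su; apply: compC_perm; last by rewrite /= Sa Ta.
    by rewrite (perm_catCA [:: S] (A :: As) (nseq l S)).
  have Au : endC A u != 0.
    have pqA : p + q = k%:Z + (size As + l.+1).+1%:Z by rewrite pq.
    apply: contraNneq u0 => Au0; apply/eqP.
    exact: (endC_inj (cone_lefschetz CA) pqA uH Au0).
  have pos : 0 < hform (p - q) L (endC A u) (endC A u).
    have szL : (size L = size As + l)%N by rewrite size_cat size_nseq.
    have pqL : (p - 1) + (q - 1) = k%:Z + (size As + l)%:Z.
      by move: pq => /=; clear; lia.
    have pqL2 : (p - 1 + 1) + (q - 1 + 1) = k%:Z + (size As + l.+2)%:Z.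
      by move: pqL; clear; lia.
    have e1 : (p - 1) - (q - 1) = p - q by clear; lia.
    have e2 : (p - 1) - (q - 1) = ((p - 1) + 1) - ((q - 1) + 1) by clear; lia.
    rewrite -e1; apply: (hodge_riemann_of_index (n := k) Sa (cone_lefschetz CS) La) => //.
    + by rewrite szL.
    + by apply: IHr => //; clear; lia.
    + rewrite e2 (@hform_catCA _ [:: S; S] As (nseq l S)) //= ?Sa ?nseqa //.
      by apply: (IHr As S l.+2) => //; clear; lia.
    + exact: H_shift.
    + by rewrite -SL /= -endC_compC //= ?Sa.
  (* The derivative, multiplied by 1 - s, in terms of A - S. *)
  have s1C : 0 < (1 - s)%:C%C :> C by rewrite (ltcR 0) subr_gt0.
  rewrite -(pmulr_rlt0 _ s1C).
  have -> : (1 - s)%:C%C * hform (p - q) (A - B :: A :: L) u u =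
      hform (p - q) (A :: A :: L) u u - hform (p - q) (S :: A :: L) u u.
    rewrite /hform mulrCA -mulrBr; congr (_ * _).
    rewrite -bilinCZr -bilinCBr; congr (bilinC Q u _) => /=.
    rewrite endC_segment endC_sub rmorphB rmorph1 /= scalerBr !scalerBl !scale1r.
    by rewrite !opprD !opprK !addrA; congr (_ + _); rewrite addrAC.
  rewrite [X in _ - X]hform_compCl /= ?Sa ?Ta //.
  rewrite [X in bilinC Q X]SL bilinC0l !mulr0 subr0.
  by rewrite -oppr_gt0 -hform_endC.
- rewrite (@hform_catCA _ [:: A] As) //= ?Ta ?nseqa //.
  by apply: (IHr As A l.+2) => //; move: pq km => /=; rewrite !addSn !addnS.
- have -> : p - q = (p + 1) - (q + 1) by clear; lia.
  rewrite (@hform_catCA _ [:: B; B] (A :: As)) //= ?cone_a ?nseqa ?cone_a //.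
  by apply: (IHn _ _ l.+3); move: pq km => /=; clear; lia.
Qed.

End HodgeLefschetz.

Unset Implicit Arguments.
Set Strict Implicit.
Set Printing Implicit Defensive.

Local Open Scope complex_scope.

(** * The mixed Hodge-Riemann bilinear relations *)

Theorem theorem4p4 (R : realType) (V : vectType R)
    (gr : int -> {vspace V}) (Q : {biscalar V}) (a : {vspace 'End(V)})
    (N0 : 'End(V)) (k : nat) (H : int -> int -> {vspace complexify V})
    (HL : polarized_hodge_lefschetz gr Q a N0 k H)
    (C : set 'End(V)) (HC : polarizing_cone gr a N0 C)
    (m : nat) (hm : (m + 2 <= k)%N)
    (T : 'I_m.+1 -> 'End(V)) (hT : forall i : 'I_m.+1, C (T i))
    (p q : int) (hpq : p + q = k%:Z + m%:Z)
    (v : complexify V) (hv : v \in H p q)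
    (hker : v \in lker (endC (\big[@comp_lfun _ _ _ _ / \1%VF]_(i < m.+1) T i))) :
  let Tm := \big[@comp_lfun _ _ _ _ / \1%VF]_(i < m) T (widen_ord (leqnSn m) i) in
  let h := 'i%C ^ (p - q) * bilinC Q v (endC Tm (vconj v)) in
  0 <= h /\ (h = 0 <-> v = 0).
Proof.
case: HC => HC _.
pose L := [seq T (widen_ord (leqnSn m) i) | i <- index_enum 'I_m].
pose B := T ord_max.
have CL S : S \in L -> C S by case/mapP=> i _ ->; apply: hT.
have szL : size L = m by rewrite size_map -[index_enum _]enumT -cardT card_ord.
have Ca S : C S -> S \in a by apply: (cone_a HC).
have La : all [in a] L by apply/allP => S /CL /Ca.
have CB : C B by apply: hT.
have Ba : B \in a by apply: Ca.
have BL0 : compC (B :: L) v = 0.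
  move: hker; rewrite memv_ker endC_big => /eqP <-.
  rewrite -[index_enum _]enumT enum_ordSr map_rcons -map_comp.
  rewrite -cats1 (compC_catC HL) /= ?Ba //.
    by rewrite /L -[index_enum _]enumT.
  by apply/allP => S /mapP[i _ ->]; apply/Ca/hT.
move=> Tm h.
have hE : h = hform Q (p - q) L v v by rewrite /h /Tm endC_big.
suff pos : v != 0 -> 0 < h.
  have [v0|/[dup] vn0 /pos h0] := eqVneq v 0.
    by rewrite hE v0 /hform bilinC0l mulr0.
  by split; [exact: ltW | split=> [h00|v0]; [move: h0; rewrite h00 ltxx | rewrite v0 eqxx in vn0]].
move=> v0; rewrite hE.
have pqL : p + q = k%:Z + (size L)%:Z by rewrite szL.
apply: (hodge_riemann_of_index (n := k) HL Ba (cone_lefschetz HC CB) La pqL) => //.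
  have := neg_index_cone (l := 0) (n := k.+1) HL HC CL CB; rewrite cats0; apply.
    by rewrite addn0.
  by clear; lia.
have e : p - q = (p + 1) - (q + 1) by clear; lia.
have -> : hform Q (p - q) (B :: B :: L) = hform Q (p - q) (L ++ nseq 2 B).
  have := @hform_catCA _ _ _ _ _ _ _ _ HL (p - q) [:: B; B] L [::].
  by rewrite /= Ba cats0; apply.
rewrite e; apply: (neg_index_cone HL HC) => //; last by clear; lia.
by move: hpq; rewrite szL; clear; lia.
Qed.
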